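(* Let $\alpha,\beta$ be real numbers with $\beta\le 1<\alpha$. Then the $\beta$-Ces\`aro operator $C_\beta$ maps $\mathcal{B}_\alpha^0$ into $\mathcal{B}_\alpha^0$ and is a bounded linear operator from $(\mathcal{B}_\alpha^0,\|\cdot\|_{\mathcal{B}_\alpha})$ to itself.
   Context: $\mathbb{D}=\{z\in\mathbb{C}:|z|<1\}$. For $\alpha>0$, the $\alpha$-Bloch space $\mathcal{B}_\alpha$ is the space of analytic functions $f$ on $\mathbb{D}$ with $\|f\|_{\mathcal{B}_\alpha}:=\sup_{z\in\mathbb{D}}(1-|z|^2)^\alpha|f'(z)|<\infty$. $\mathcal{B}_\alpha^0=\{f\in\mathcal{B}_\alpha: f(0)=0\}$, normed by $\|\cdot\|_{\mathcal{B}_\alpha}$. For $\beta\in\mathbb{R}$, the $\beta$-Ces\`aro operator is $C_\beta(f)(z)=\int_0^z \frac{f(w)}{w(1-w)^\beta}\,dw$ for analytic $f$ on $\mathbb{D}$ with $f(0)=0$, where $(1-w)^{\beta}$ is defined by the principal branch. *)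

(* Defs.v *)
From Stdlib Require Import Reals.
From Coquelicot Require Export Coquelicot.
Open Scope R_scope.

Definition cexp (z : C) : C := (exp (fst z) * cos (snd z), exp (fst z) * sin (snd z)).

(* principal argument, with values in (-PI, PI] (Arg 0 := 0) *)
Definition Arg (u : C) : R :=
  let x := fst u in let y := snd u in
  if Rlt_dec 0 x then atan (y / x)
  else if Rlt_dec x 0 then
    (if Rle_dec 0 y then atan (y / x) + PI else atan (y / x) - PI)
  else if Rlt_dec 0 y then PI / 2
  else if Rlt_dec y 0 then - (PI / 2) else 0.

Definition Clog (u : C) : C := (ln (Cmod u), Arg u).

(* principal branch of u^b, b real (for u <> 0) *)
Definition cpow (u : C) (b : R) : C := cexp (Cmult (RtoC b) (Clog u)).

Definition in_disk (z : C) : Prop := Cmod z < 1.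

Definition analytic_on_disk (f : C -> C) : Prop :=
  forall z, in_disk z -> @ex_derive C_AbsRing C_NormedModule f z.

Definition cderiv (f : C -> C) (z : C) : C :=
  C_derive f z.

Definition bloch_weight (alpha : R) (f : C -> C) (z : C) : R :=
  Rpower (1 - Cmod z ^ 2) alpha * Cmod (cderiv f z).

Definition bloch_norm (alpha : R) (f : C -> C) : Rbar :=
  Lub_Rbar (fun r => exists z, in_disk z /\ r = bloch_weight alpha f z).

Definition bloch (alpha : R) (f : C -> C) : Prop :=
  analytic_on_disk f /\ is_finite (bloch_norm alpha f).

Definition bloch0 (alpha : R) (f : C -> C) : Prop :=
  bloch alpha f /\ f (RtoC 0) = RtoC 0.

(* beta-Cesaro operator: integral over the segment [0,z], w = t z, dw = z dt *)
Definition cesaro (beta : R) (f : C -> C) (z : C) : C :=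
  @RInt C_R_CompleteNormedModule
    (fun t : R => let w := Cmult (RtoC t) z in
       Cmult (Cdiv (f w) (Cmult w (cpow (Cminus (RtoC 1) w) beta))) z) 0 1.

(* Main.v *)
(* The integrand [f w / (w (1 - w)^beta)] extends continuously to the origin and is holomorphic on
   the rest of the disk.  Goursat's theorem for triangles away from the origin, together with
   shrinking a triangle with a vertex at the origin, shows that its integral over the segment
   [[0, z]] is a primitive; so the derivative of the Cesaro transform is the integrand itself.
   Integrating the Bloch bound on f' along rays gives
   [|f z| <= C ||f|| |z| (1 - |z|)^(1 - alpha)], one power of [1 - |z|] better than needed, and as
   [beta <= 1] this power absorbs [|1 - z|^(- beta) <= 2^(1 - beta) / (1 - |z|)]. *)

Require Import Defs.
From Stdlib Require Import Reals.
From Coquelicot Require Import Coquelicot.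
From Stdlib Require Import Lra Classical IndefiniteDescription.
Open Scope R_scope.

(** * Differentiability in one complex variable *)

(** The obstacle is the origin. Differentiability of [f w / w] at [0] is second-order information on
    [f], which follows from differentiability of [f] only through Cauchy's theory; continuity at [0]
    is no more than the existence of the derivative of [f] there. Hence the primitive is built from
    differentiability off [0] and mere continuity at [0]. The growth bound has to keep the factor
    [|z|], because the new derivative contains [f z / z]. The hypothesis [1 < alpha] enters there:
    the integral of [(1 - s)^(- alpha)] over [[0, r]] is of order [(1 - r)^(1 - alpha)], while for
    [alpha = 1] it is a logarithm, which at [beta = 1] nothing would absorb. *)

Lemma is_derive_C_eps (f : C -> C) (z l : C) :
  @is_derive C_AbsRing C_NormedModule f z l <->
  (forall eps, 0 < eps -> exists d, 0 < d /\ forall w, Cmod (w - z) < d ->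
     Cmod (f w - f z - l * (w - z)) <= eps * Cmod (w - z)).
Proof.
  split.
  - intros [_ H] eps Heps.
    destruct (H z (fun P HP => HP) (mkposreal eps Heps)) as [d Hd].
    exists d; split; [apply cond_pos|]. intros w Hw.
    specialize (Hd w). simpl in Hd.
    specialize (Hd Hw).
    replace (f w - f z - l * (w - z))%C
      with (minus (minus (f w) (f z)) (scal (minus w z) l) : C_NormedModule).
    + exact Hd.
    + change ((f w - f z) - ((w - z) * l) = f w - f z - l * (w - z))%C. ring.
  - intros H. split; [apply is_linear_scal_l|].
    intros x Hx.
    apply (@is_filter_lim_locally_unique C_AbsRing (AbsRing_NormedModule C_AbsRing)) in Hx.
    subst x.
    intros eps. destruct (H eps (cond_pos eps)) as [d [Hd0 Hd]].
    exists (mkposreal _ Hd0). intros w Hw.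
    specialize (Hd w Hw).
    change (Cmod ((f w - f z) - ((w - z) * l)) <= eps * Cmod (w - z))%R.
    replace ((f w - f z) - ((w - z) * l))%C with (f w - f z - l * (w - z))%C by ring.
    exact Hd.
Qed.

(** The balls of [C_UniformSpace] are squares, those of [Cmod] are round: a disk lies in the square
    of the same radius, a square in the disk of radius [sqrt 2] times larger. *)
Lemma continuous_C_eps (f : C -> C) (z : C) :
  @continuous C_UniformSpace C_UniformSpace f z <->
  (forall eps, 0 < eps -> exists d, 0 < d /\ forall w, Cmod (w - z) < d ->
     Cmod (f w - f z) < eps).
Proof.
  assert (S2 : 0 < sqrt 2) by (apply sqrt_lt_R0; lra).
  split.
  - intros H eps Heps.
    assert (He : 0 < eps / sqrt 2) by (apply Rdiv_lt_0_compat; lra).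
    destruct (H (fun y => @ball C_UniformSpace (f z) (eps / sqrt 2) y)) as [d Hd].
    { exists (mkposreal _ He). intros y Hy; exact Hy. }
    exists d; split; [apply cond_pos|]. intros w Hw.
    specialize (Hd w (C_NormedModule_mixin_compat1 z w d Hw)).
    pose proof (C_NormedModule_mixin_compat2 (f z) (f w) (mkposreal _ He) Hd) as B. simpl in B.
    replace (sqrt 2 * (eps / sqrt 2)) with eps in B by (field; lra). exact B.
  - intros H P [e HP]. destruct (H e (cond_pos e)) as [d [Hd0 Hd]].
    assert (Hd2 : 0 < d / sqrt 2) by (apply Rdiv_lt_0_compat; lra).
    exists (mkposreal _ Hd2). intros w Hw. apply HP.
    apply C_NormedModule_mixin_compat1. apply Hd.
    pose proof (C_NormedModule_mixin_compat2 z w _ Hw) as B. simpl in B.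
    replace (sqrt 2 * (d / sqrt 2)) with d in B by (field; lra). exact B.
Qed.

Lemma norm_C_R (x : C) : @norm R_AbsRing C_R_NormedModule x = Cmod x.
Proof.
  unfold Cmod. simpl. cbv [norm]. simpl. unfold prod_norm. f_equal.
  change (Rabs (fst x) * (Rabs (fst x) * 1) + Rabs (snd x) * (Rabs (snd x) * 1)
    = fst x * (fst x * 1) + snd x * (snd x * 1)).
  pose proof (Rsqr_abs (fst x)). pose proof (Rsqr_abs (snd x)). unfold Rsqr in *. lra.
Qed.

(** The two real differentials are the components of multiplication by [p + i q], so the real
    remainders are the components of the complex remainder; each gets half of [eps]. *)
Lemma is_derive_Cauchy_Riemann (f : C -> C) (z : C) (p q : R) :
  @filterdiff R_AbsRing C_R_NormedModule R_NormedModule (fun u => fst (f u)) (locally z)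
     (fun h => p * fst h - q * snd h) ->
  @filterdiff R_AbsRing C_R_NormedModule R_NormedModule (fun u => snd (f u)) (locally z)
     (fun h => q * fst h + p * snd h) ->
  @is_derive C_AbsRing C_NormedModule f z (p, q).
Proof.
  intros [_ H1] [_ H2]. apply is_derive_C_eps. intros eps Heps.
  assert (He : 0 < eps / 2) by lra.
  destruct (H1 z (fun P HP => HP) (mkposreal _ He)) as [d1 Hd1].
  destruct (H2 z (fun P HP => HP) (mkposreal _ He)) as [d2 Hd2].
  exists (Rmin d1 d2). split; [apply Rmin_glb_lt; apply cond_pos|].
  intros w Hw.
  assert (B1 : @ball C_UniformSpace z d1 w).
  { apply C_NormedModule_mixin_compat1. eapply Rlt_le_trans; [exact Hw|apply Rmin_l]. }
  assert (B2 : @ball C_UniformSpace z d2 w).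
  { apply C_NormedModule_mixin_compat1. eapply Rlt_le_trans; [exact Hw|apply Rmin_r]. }
  specialize (Hd1 w B1). specialize (Hd2 w B2).
  rewrite norm_C_R in Hd1, Hd2. simpl in Hd1, Hd2.
  change (minus w z) with (w - z)%C in Hd1, Hd2.
  set (E := (f w - f z - (p, q) * (w - z))%C).
  assert (E1 : Rabs (fst E) <= eps / 2 * Cmod (w - z)).
  { refine (Rle_trans _ _ _ _ Hd1). right. unfold E. simpl. apply (f_equal Rabs).
    unfold minus, plus, opp; simpl. ring. }
  assert (E2 : Rabs (snd E) <= eps / 2 * Cmod (w - z)).
  { refine (Rle_trans _ _ _ _ Hd2). right. unfold E. simpl. apply (f_equal Rabs).
    unfold minus, plus, opp; simpl. ring. }
  assert (Cmod E <= Rabs (fst E) + Rabs (snd E)).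
  { replace E with (RtoC (fst E) + Ci * RtoC (snd E))%C at 1.
    - eapply Rle_trans; [apply Cmod_triangle|]. rewrite Cmod_mult, Cmod_Ci, !Cmod_R. lra.
    - destruct E as [a b]. unfold RtoC, Ci, Cplus, Cmult; simpl. f_equal; ring. }
  lra.
Qed.

(** [is_derive_filterdiff] asks for the [x]-partial in a neighbourhood, continuous at the point, and
    for the [y]-partial at the point only. *)
Lemma is_derive_cexp (z : C) : @is_derive C_AbsRing C_NormedModule cexp z (cexp z).
Proof.
  destruct z as [x y]. unfold cexp at 2. simpl. apply is_derive_Cauchy_Riemann; simpl.
  - refine (filterdiff_ext_lin _ _ _ (is_derive_filterdiff (fun x y => exp x * cos y) x y
      (fun x y => exp x * cos y) (- (exp x * sin y)) _ _ _) _).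
    + apply filter_forall. intros u. auto_derive; [trivial|ring].
    + auto_derive; [trivial|ring].
    + apply (continuous_mult (fun u : R * R => exp (fst u)) (fun u => cos (snd u))).
      * apply continuous_comp; [apply continuous_fst|apply continuous_exp].
      * apply continuous_comp; [apply continuous_snd|apply continuous_cos].
    + intros [h k]. unfold scal, plus, mult; simpl. unfold mult; simpl. ring.
  - refine (filterdiff_ext_lin _ _ _ (is_derive_filterdiff (fun x y => exp x * sin y) x y
      (fun x y => exp x * sin y) (exp x * cos y) _ _ _) _).
    + apply filter_forall. intros u. auto_derive; [trivial|ring].
    + auto_derive; [trivial|ring].
    + apply (continuous_mult (fun u : R * R => exp (fst u)) (fun u => sin (snd u))).
      * apply continuous_comp; [apply continuous_fst|apply continuous_exp].
      * apply continuous_comp; [apply continuous_snd|apply continuous_sin].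
    + intros [h k]. unfold scal, plus, mult; simpl. unfold mult; simpl. ring.
Qed.

Lemma locally_fst_pos (z : C) : 0 < fst z -> locally z (fun u : C => 0 < fst u).
Proof.
  intros Hz. exists (mkposreal _ Hz). intros u [B _].
  apply Rabs_def2 in B. unfold minus, plus, opp in B; simpl in B. lra.
Qed.

(** The right half-plane suffices, since [1 - w] stays in it for [w] in the disk, and there [Arg] is
    the single formula [atan (y / x)]. *)
Lemma is_derive_Clog (z : C) :
  0 < fst z -> @is_derive C_AbsRing C_NormedModule Clog z (/ z)%C.
Proof.
  intros Hz. pose proof (locally_fst_pos z Hz) as Hloc.
  destruct z as [x y]. simpl in Hz.
  assert (Pos : forall u v, 0 < u -> 0 < u ^ 2 + v ^ 2) by (intros; nra).
  assert (Cont : continuous (fun u : R * R => / (fst u ^ 2 + snd u ^ 2)) (x, y)).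
  { apply continuous_comp.
    - apply (continuous_plus (fun u : R * R => fst u ^ 2) (fun u => snd u ^ 2)).
      + simpl. apply (continuous_mult (fun u : R * R => fst u) (fun u => fst u * 1)).
        apply continuous_fst.
        apply (continuous_mult (fun u : R * R => fst u) (fun u => 1)).
        apply continuous_fst. apply continuous_const.
      + simpl. apply (continuous_mult (fun u : R * R => snd u) (fun u => snd u * 1)).
        apply continuous_snd.
        apply (continuous_mult (fun u : R * R => snd u) (fun u => 1)).
        apply continuous_snd. apply continuous_const.
    - apply continuous_Rinv. apply Rgt_not_eq, Pos, Hz. }
  assert (Sq : forall u v, 0 < u -> sqrt (u ^ 2 + v ^ 2) * sqrt (u ^ 2 + v ^ 2) = u ^ 2 + v ^ 2).
  { intros u v Hu. apply sqrt_sqrt. specialize (Pos u v Hu). lra. }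
  unfold Cinv. simpl fst. simpl snd. apply is_derive_Cauchy_Riemann.
  - refine (filterdiff_ext_lin _ _ _ (is_derive_filterdiff (fun x y => ln (sqrt (x ^ 2 + y ^ 2))) x y
      (fun x y => x * / (x ^ 2 + y ^ 2)) (y * / (x ^ 2 + y ^ 2)) _ _ _) _).
    + revert Hloc. apply filter_imp. intros [u v] Hu. simpl in Hu |- *.
      specialize (Pos u v Hu). specialize (Sq u v Hu).
      pose proof (sqrt_lt_R0 _ Pos).
      auto_derive; simpl in *; [repeat split; lra|].
      set (s := sqrt _) in *. rewrite <- Sq. field. lra.
    + specialize (Pos x y Hz). specialize (Sq x y Hz).
      pose proof (sqrt_lt_R0 _ Pos).
      auto_derive; simpl in *; [repeat split; lra|].
      set (s := sqrt _) in *. rewrite <- Sq. field. lra.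
    + apply (continuous_mult (fun u : R * R => fst u) (fun u => / (fst u ^ 2 + snd u ^ 2)));
        [apply continuous_fst | exact Cont].
    + intros [h k]. unfold scal, plus, mult; simpl. unfold mult; simpl. field.
      specialize (Pos x y Hz). simpl in Pos. lra.
  - apply (@filterdiff_ext_locally R_AbsRing C_R_NormedModule R_NormedModule
      (fun u : C => atan (snd u / fst u))).
    { revert Hloc. apply filter_imp. intros [u v] Hu. simpl in Hu |- *.
      unfold Arg. simpl. destruct (Rlt_dec 0 u); [reflexivity|contradiction]. }
    refine (filterdiff_ext_lin _ _ _ (is_derive_filterdiff (fun x y => atan (y / x)) x y
      (fun x y => - y * / (x ^ 2 + y ^ 2)) (x * / (x ^ 2 + y ^ 2)) _ _ _) _).
    + revert Hloc. apply filter_imp. intros [u v] Hu. simpl in Hu |- *.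
      specialize (Pos u v Hu).
      auto_derive; simpl in *; [repeat split; lra|].
      unfold Rsqr. field. repeat split; try lra; nra.
    + specialize (Pos x y Hz).
      auto_derive; simpl in *; [repeat split; lra|].
      unfold Rsqr. field. repeat split; try lra; nra.
    + apply (continuous_mult (fun u : R * R => - snd u) (fun u => / (fst u ^ 2 + snd u ^ 2)));
        [|exact Cont].
      apply (continuous_opp (fun u : R * R => snd u)). apply continuous_snd.
    + intros [h k]. unfold scal, plus, mult; simpl. unfold mult; simpl. field.
      specialize (Pos x y Hz). simpl in Pos. lra.
Qed.

(* The two normed modules carry the same norm but different uniform structures. *)
Lemma is_derive_C_AbsRing (f : C -> C) (z l : C) :
  @is_derive C_AbsRing C_NormedModule f z l <->
  @is_derive C_AbsRing (AbsRing_NormedModule C_AbsRing) f z l.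
Proof.
  split; intros [H1 H2]; (split; [apply is_linear_scal_l|]);
    intros x Hx eps; exact (H2 x Hx eps).
Qed.

Lemma is_derive_C_mult (f g : C -> C) (z lf lg : C) :
  @is_derive C_AbsRing C_NormedModule f z lf ->
  @is_derive C_AbsRing C_NormedModule g z lg ->
  @is_derive C_AbsRing C_NormedModule (fun w => f w * g w)%C z (lf * g z + f z * lg)%C.
Proof.
  rewrite !is_derive_C_AbsRing. intros Hf Hg.
  exact (@is_derive_mult C_AbsRing f g z lf lg Hf Hg Cmult_comm).
Qed.

Lemma is_derive_C_comp (f g : C -> C) (z lf lg : C) :
  @is_derive C_AbsRing C_NormedModule f (g z) lf ->
  @is_derive C_AbsRing C_NormedModule g z lg ->
  @is_derive C_AbsRing C_NormedModule (fun w => f (g w)) z (lg * lf)%C.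
Proof.
  intros Hf Hg. apply is_derive_C_AbsRing in Hg.
  exact (@is_derive_comp C_AbsRing C_NormedModule f g z lf lg Hf Hg).
Qed.

Lemma is_derive_C_continuous (f : C -> C) (z l : C) :
  @is_derive C_AbsRing C_NormedModule f z l -> @continuous C_UniformSpace C_UniformSpace f z.
Proof.
  intros H. apply continuous_C_eps. intros eps Heps.
  destruct (proj1 (is_derive_C_eps f z l) H 1 Rlt_0_1) as [d [Hd Hf]].
  pose proof (Cmod_ge_0 l) as Hl.
  assert (Hd' : 0 < eps / (2 + Cmod l)) by (apply Rdiv_lt_0_compat; lra).
  exists (Rmin d (eps / (2 + Cmod l))). split; [apply Rmin_glb_lt; assumption|].
  intros w Hw.
  assert (W1 := Rlt_le_trans _ _ _ Hw (Rmin_l _ _)).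
  assert (W2 := Rlt_le_trans _ _ _ Hw (Rmin_r _ _)).
  specialize (Hf w W1).
  replace (f w - f z)%C with ((f w - f z - l * (w - z)) + l * (w - z))%C by ring.
  eapply Rle_lt_trans; [apply Cmod_triangle|]. rewrite Cmod_mult.
  pose proof (Cmod_ge_0 (w - z)).
  apply (Rmult_lt_compat_r (2 + Cmod l)) in W2; [|lra].
  replace (eps / (2 + Cmod l) * (2 + Cmod l)) with eps in W2 by (field; lra).
  nra.
Qed.

Lemma is_derive_Cinv (z : C) :
  z <> RtoC 0 -> @is_derive C_AbsRing C_NormedModule Cinv z (- / (z * z))%C.
Proof.
  intros Hz. apply is_derive_C_eps. intros eps Heps.
  pose proof (proj1 (Cmod_gt_0 z) Hz) as P.
  set (m := Cmod z) in *.
  assert (P2 : 0 < eps * m ^ 3 / 2).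
  { apply Rdiv_lt_0_compat; [|lra]. apply Rmult_lt_0_compat; [lra|]. apply pow_lt; lra. }
  exists (Rmin (m / 2) (eps * m ^ 3 / 2)). split; [apply Rmin_glb_lt; lra|].
  intros w Hw.
  assert (W1 := Rlt_le_trans _ _ _ Hw (Rmin_l _ _)).
  assert (W2 := Rlt_le_trans _ _ _ Hw (Rmin_r _ _)).
  assert (Mw : m / 2 <= Cmod w).
  { pose proof (Cmod_triangle w (- (w - z))) as T.
    replace (w + - (w - z))%C with z in T by ring. rewrite Cmod_opp in T.
    fold m in T. lra. }
  assert (Nw : w <> RtoC 0) by (apply Cmod_gt_0; lra).
  replace (/ w - / z - - / (z * z) * (w - z))%C with ((w - z) * (w - z) / (w * (z * z)))%C
    by (field; split; assumption).
  rewrite Cmod_div; [|repeat apply Cmult_neq_0; assumption].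
  rewrite !Cmod_mult. fold m.
  pose proof (Cmod_ge_0 (w - z)) as Q. set (q := Cmod (w - z)) in *.
  assert (0 < m * m) by nra.
  assert (D : 0 < Cmod w * (m * m)) by (apply Rmult_lt_0_compat; lra).
  apply Rmult_le_reg_r with (Cmod w * (m * m)); [exact D|].
  replace (q * q / (Cmod w * (m * m)) * (Cmod w * (m * m))) with (q * q) by (field; lra).
  assert (eps * m ^ 3 / 2 <= eps * (Cmod w * (m * m))).
  { replace (eps * m ^ 3 / 2) with (eps * ((m / 2) * (m * m))) by field.
    apply Rmult_le_compat_l; [lra|]. apply Rmult_le_compat_r; lra. }
  nra.
Qed.

Lemma ex_derive_cpow (b : R) (z : C) :
  0 < fst z -> @ex_derive C_AbsRing C_NormedModule (fun u => cpow u b) z.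
Proof.
  intros Hz. eexists. unfold cpow.
  apply (is_derive_C_comp cexp (fun u => RtoC b * Clog u)%C).
  - apply is_derive_cexp.
  - apply (is_derive_C_mult (fun _ => RtoC b) Clog).
    + apply (@is_derive_const C_AbsRing C_NormedModule).
    + apply is_derive_Clog, Hz.
Qed.

(** As [b] is real, the argument enters only the imaginary part of the exponent, which [cexp] turns
    into a rotation. *)
Lemma Cmod_cpow (b : R) (z : C) : Cmod (cpow z b) = Rpower (Cmod z) b.
Proof.
  unfold cpow, cexp, Clog, Rpower. unfold Cmod at 1. simpl.
  set (t := b * _ + _). set (r := ln (Cmod z)).
  replace (b * r - 0 * _) with (b * r) by ring.
  transitivity (sqrt (exp (b * r) * exp (b * r))).
  - f_equal. pose proof (sin2_cos2 t). unfold Rsqr in H. nra.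
  - apply sqrt_square. left. apply exp_pos.
Qed.

(** * Goursat's theorem and primitives in the disk *)

(** Integral lemmas leave equalities typed in the carrier of a normed module; retyping them in [C]
    lets [ring] recognise the field. *)
Ltac Cring := match goal with |- ?x = ?y => change (@eq C x y) end; ring.

Definition seg (a b : C) (t : R) : C := (a + RtoC t * (b - a))%C.

Definition seg_int (g : C -> C) (a b : C) : C :=
  @RInt C_R_CompleteNormedModule (fun t => g (seg a b t) * (b - a))%C 0 1.

Definition continuous_on_seg (g : C -> C) (a b : C) : Prop :=
  forall t, 0 <= t <= 1 -> @continuous C_UniformSpace C_UniformSpace g (seg a b t).

Lemma scal_R_C (t : R) (z : C) : @scal R_AbsRing C_R_NormedModule t z = (RtoC t * z)%C.
Proof.
  destruct z as [x y]. unfold scal; simpl. unfold prod_scal, scal; simpl.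
  unfold mult, Cmult; simpl. f_equal; ring.
Qed.

Lemma continuous_Cmult_r (c : C) (z : C) :
  @continuous C_UniformSpace C_UniformSpace (fun w => w * c)%C z.
Proof.
  eapply is_derive_C_continuous.
  apply (is_derive_C_mult (fun w => w) (fun _ => c)).
  - apply is_derive_C_AbsRing, (@is_derive_id C_AbsRing).
  - apply (@is_derive_const C_AbsRing C_NormedModule).
Qed.

Lemma continuous_seg (a b : C) (t : R) : @continuous R_UniformSpace C_UniformSpace (seg a b) t.
Proof.
  apply (@continuous_ext R_UniformSpace C_UniformSpace
    (fun t => @plus C_R_NormedModule a (@scal R_AbsRing C_R_NormedModule t (b - a)%C))).
  - intros u. rewrite scal_R_C. reflexivity.
  - apply (@continuous_plus R_UniformSpace R_AbsRing C_R_NormedModule (fun _ => a)).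
    + apply continuous_const.
    + apply (@continuous_scal_l R_UniformSpace R_AbsRing C_R_NormedModule (fun t => t)).
      apply continuous_id.
Qed.

Lemma is_RInt_seg_int (g : C -> C) (a b : C) :
  continuous_on_seg g a b ->
  @is_RInt C_R_NormedModule (fun t => g (seg a b t) * (b - a))%C 0 1 (seg_int g a b).
Proof.
  intros H. apply (@RInt_correct C_R_CompleteNormedModule).
  apply (@ex_RInt_continuous C_R_CompleteNormedModule). intros t Ht.
  rewrite Rmin_left, Rmax_right in Ht by lra.
  apply (@continuous_comp R_UniformSpace C_UniformSpace C_UniformSpace
    (fun t => g (seg a b t)) (fun w => w * (b - a))%C).
  - apply (@continuous_comp R_UniformSpace C_UniformSpace C_UniformSpace (seg a b) g).
    + apply continuous_seg.
    + apply H, Ht.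
  - apply continuous_Cmult_r.
Qed.

Lemma seg_int_unique (g : C -> C) (a b l : C) :
  @is_RInt C_R_NormedModule (fun t => g (seg a b t) * (b - a))%C 0 1 l -> seg_int g a b = l.
Proof. apply (@is_RInt_unique C_R_CompleteNormedModule). Qed.

Lemma seg_int_swap (g : C -> C) (a b : C) :
  continuous_on_seg g a b -> seg_int g b a = (- seg_int g a b)%C.
Proof.
  assert (N1 : RtoC (-1) = (- RtoC 1)%C) by (rewrite <- RtoC_opp; f_equal; ring).
  intros H. apply seg_int_unique. apply is_RInt_seg_int, is_RInt_swap in H.
  pose proof (@is_RInt_comp_lin C_R_NormedModule (fun t => g (seg a b t) * (b - a))%C (-1) 1 0 1
     (- seg_int g a b)%C) as L.
  replace (-1 * 0 + 1) with 1 in L by ring. replace (-1 * 1 + 1) with 0 in L by ring.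
  refine (@is_RInt_ext C_R_NormedModule _ _ _ _ _ _ (L H)).
  intros t _. rewrite scal_R_C. unfold seg.
  replace (b + RtoC t * (a - b))%C with (a + RtoC (-1 * t + 1) * (b - a))%C.
  - rewrite N1. Cring.
  - rewrite RtoC_plus, RtoC_mult, N1. ring.
Qed.

Lemma seg_int_refl (g : C -> C) (a : C) : seg_int g a a = RtoC 0.
Proof.
  apply seg_int_unique. apply (@is_RInt_ext C_R_NormedModule (fun _ => RtoC 0)).
  - intros t _. Cring.
  - pose proof (@is_RInt_const C_R_NormedModule 0 1 (RtoC 0)) as L.
    rewrite scal_R_C in L. replace (RtoC (1 - 0) * RtoC 0)%C with (RtoC 0) in L by ring.
    exact L.
Qed.

Lemma seg_int_split (g : C -> C) (a b : C) (s : R) :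
  0 <= s <= 1 -> continuous_on_seg g a b ->
  seg_int g a b = (seg_int g a (seg a b s) + seg_int g (seg a b s) b)%C.
Proof.
  intros Hs H. set (m := seg a b s).
  assert (H1 : continuous_on_seg g a m).
  { intros t Ht. replace (seg a m t) with (seg a b (s * t)). apply H; nra.
    unfold m, seg. rewrite RtoC_mult. ring. }
  assert (H2 : continuous_on_seg g m b).
  { intros t Ht. replace (seg m b t) with (seg a b ((1 - s) * t + s)). apply H; nra.
    unfold m, seg. rewrite RtoC_plus, RtoC_mult, RtoC_minus. ring. }
  set (phi := (fun t => g (seg a b t) * (b - a))%C).
  assert (E : forall u v, 0 <= u <= 1 -> 0 <= v <= 1 ->
     @is_RInt C_R_NormedModule phi u v (@RInt C_R_CompleteNormedModule phi u v)).
  { intros u v Hu Hv. apply (@RInt_correct C_R_CompleteNormedModule).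
    pose proof (is_RInt_seg_int g a b H) as L.
    apply (@ex_RInt_Chasles C_R_NormedModule) with 0.
    - apply (@ex_RInt_swap C_R_NormedModule).
      apply (@ex_RInt_Chasles_1 C_R_CompleteNormedModule) with 1; [exact Hu | eexists; exact L].
    - apply (@ex_RInt_Chasles_1 C_R_CompleteNormedModule) with 1; [exact Hv | eexists; exact L]. }
  assert (A1 : seg_int g a m = @RInt C_R_CompleteNormedModule phi 0 s).
  { apply seg_int_unique.
    pose proof (@is_RInt_comp_lin C_R_NormedModule phi s 0 0 1 (@RInt C_R_CompleteNormedModule phi 0 s)) as L.
    replace (s * 0 + 0) with 0 in L by ring. replace (s * 1 + 0) with s in L by ring.
    refine (@is_RInt_ext C_R_NormedModule _ _ _ _ _ _ (L (E _ _ _ _))); try lra.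
    intros t _. rewrite scal_R_C. unfold phi.
    replace (seg a b (s * t + 0)) with (seg a m t).
    - unfold m, seg. Cring.
    - unfold m, seg. rewrite RtoC_plus, RtoC_mult. ring. }
  assert (A2 : seg_int g m b = @RInt C_R_CompleteNormedModule phi s 1).
  { apply seg_int_unique.
    pose proof (@is_RInt_comp_lin C_R_NormedModule phi (1 - s) s 0 1 (@RInt C_R_CompleteNormedModule phi s 1)) as L.
    replace ((1 - s) * 0 + s) with s in L by ring. replace ((1 - s) * 1 + s) with 1 in L by ring.
    refine (@is_RInt_ext C_R_NormedModule _ _ _ _ _ _ (L (E _ _ _ _))); try lra.
    intros t _. rewrite scal_R_C. unfold phi.
    replace (seg a b ((1 - s) * t + s)) with (seg m b t).
    - unfold m, seg. rewrite RtoC_minus. Cring.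
    - unfold m, seg. rewrite RtoC_plus, RtoC_mult, RtoC_minus. ring. }
  rewrite A1, A2. apply seg_int_unique.
  apply (@is_RInt_Chasles C_R_NormedModule) with s; apply E; lra.
Qed.

Lemma is_RInt_affine_C (A B : C) :
  @is_RInt C_R_NormedModule (fun t => A + RtoC t * B)%C 0 1 (A + RtoC (1 / 2) * B)%C.
Proof.
  assert (L : forall x y, is_RInt (fun t => x + t * y) 0 1 (x + 1 / 2 * y)).
  { intros x y.
    replace (x + 1 / 2 * y) with (minus ((fun t => t * x + t ^ 2 / 2 * y) 1) ((fun t => t * x + t ^ 2 / 2 * y) 0))
      by (unfold minus, plus, opp; simpl; field).
    apply (@is_RInt_derive R_CompleteNormedModule (fun t => t * x + t ^ 2 / 2 * y)).
    - intros t _. auto_derive; [trivial|]. simpl. field.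
    - intros t _. apply (continuous_plus (fun _ => x) (fun t => t * y)).
      + apply continuous_const.
      + apply (continuous_mult (fun t => t) (fun _ => y)).
        apply continuous_id. apply continuous_const. }
  destruct A as [a1 a2], B as [b1 b2].
  pose proof (@is_RInt_fct_extend_pair R_NormedModule R_NormedModule
    (fun t => (a1, a2) + RtoC t * (b1, b2))%C 0 1 (a1 + 1 / 2 * b1) (a2 + 1 / 2 * b2)) as P.
  replace ((a1, a2) + RtoC (1 / 2) * (b1, b2))%C with (a1 + 1 / 2 * b1, a2 + 1 / 2 * b2).
  - apply P; (eapply is_RInt_ext; [|apply L]); intros t _; simpl; ring.
  - unfold Cplus, Cmult, RtoC; simpl. f_equal; ring.
Qed.

(** The subtracted term is the increment from [a] to [b] of [c w + l (w - p)^2 / 2], a primitive of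
    the affine approximation [c + l (w - p)]. Such increments cancel around a closed triangle, and
    what remains is at most error times length. *)
Lemma seg_int_affine_approx (g : C -> C) (a b p c l : C) (M : R) :
  continuous_on_seg g a b ->
  (forall t, 0 <= t <= 1 -> Cmod (g (seg a b t) - c - l * (seg a b t - p)) <= M) ->
  Cmod (seg_int g a b
    - (c * (b - a) + l * RtoC (1 / 2) * ((b - p) * (b - p) - (a - p) * (a - p)))) <= M * Cmod (b - a).
Proof.
  intros H HM. pose proof (is_RInt_seg_int g a b H) as L1.
  pose proof (is_RInt_affine_C ((c + l * (a - p)) * (b - a))%C (l * (b - a) * (b - a))%C) as L2.
  pose proof (@is_RInt_minus C_R_NormedModule _ _ _ _ _ _ L1 L2) as L3.
  apply (@norm_RInt_le_const C_R_NormedModule) with (M := M * Cmod (b - a)) in L3; [| lra |].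
  - rewrite norm_C_R in L3. rewrite Rminus_0_r, Rmult_1_l in L3.
    eapply Rle_trans; [right|exact L3]. f_equal.
    unfold minus, plus, opp. simpl.
    change (seg_int g a b - (c * (b - a) + l * RtoC (1 / 2) * ((b - p) * (b - p) - (a - p) * (a - p)))
      = seg_int g a b - ((c + l * (a - p)) * (b - a) + RtoC (1 / 2) * (l * (b - a) * (b - a))))%C.
    assert (HH : RtoC (1 / 2) = (/ (1 + 1))%C).
    { unfold RtoC, Cinv; simpl. f_equal; field. }
    rewrite HH. field.
  - intros t Ht. rewrite norm_C_R.
    change (Cmod (g (seg a b t) * (b - a)
      - ((c + l * (a - p)) * (b - a) + RtoC t * (l * (b - a) * (b - a)))) <= M * Cmod (b - a)).
    replace (_ - _)%C with ((g (seg a b t) - c - l * (seg a b t - p)) * (b - a))%C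
      by (unfold seg; ring).
    rewrite Cmod_mult. apply Rmult_le_compat_r; [apply Cmod_ge_0 | apply HM, Ht].
Qed.

(** * Goursat's theorem by repeated bisection of triangles *)

Definition tri_int (g : C -> C) (a b c : C) : C :=
  (seg_int g a b + seg_int g b c + seg_int g c a)%C.

Definition perimeter (a b c : C) : R := Cmod (b - a) + Cmod (c - b) + Cmod (a - c).

Definition convex (K : C -> Prop) : Prop :=
  forall x y t, K x -> K y -> 0 <= t <= 1 -> K (seg x y t).

Lemma Cmod_half (x : C) : Cmod (RtoC (1 / 2) * x) = Cmod x / 2.
Proof. rewrite Cmod_mult, Cmod_R, Rabs_right; lra. Qed.

(** Joining the midpoints of the sides gives four triangles whose inner edges are traversed in both
    directions, so the four integrals add up to the whole and one of them carries at least a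
    quarter. The bound on [a' - a] later makes the first vertices a Cauchy sequence. *)
Lemma tri_int_quarter (g : C -> C) (K : C -> Prop) (a b c : C) :
  convex K -> (forall w, K w -> @continuous C_UniformSpace C_UniformSpace g w) ->
  K a -> K b -> K c ->
  exists a' b' c', K a' /\ K b' /\ K c' /\
    perimeter a' b' c' = perimeter a b c / 2 /\
    Cmod (a' - a) <= perimeter a b c /\
    Cmod (tri_int g a b c) / 4 <= Cmod (tri_int g a' b' c').
Proof.
  intros HK Hg Ka Kb Kc.
  assert (CS : forall x y, K x -> K y -> continuous_on_seg g x y).
  { intros x y Kx Ky t Ht. apply Hg, HK; assumption. }
  assert (h01 : 0 <= 1 / 2 <= 1) by lra.
  set (m1 := seg a b (1 / 2)). set (m2 := seg b c (1 / 2)). set (m3 := seg c a (1 / 2)).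
  assert (K1 : K m1) by (apply HK; assumption).
  assert (K2 : K m2) by (apply HK; assumption).
  assert (K3 : K m3) by (apply HK; assumption).
  assert (Sum : tri_int g a b c = (tri_int g a m1 m3 + tri_int g m1 b m2
                + (tri_int g m3 m2 c + tri_int g m1 m2 m3))%C).
  { unfold tri_int.
    rewrite (seg_int_split g a b (1 / 2)), (seg_int_split g b c (1 / 2)),
      (seg_int_split g c a (1 / 2)) by auto.
    fold m1 m2 m3.
    rewrite (seg_int_swap g m1 m3), (seg_int_swap g m1 m2), (seg_int_swap g m2 m3) by auto.
    ring. }
  (* [RtoC (1 / 2)] is an atom for [ring]; the midpoint identities below rest on this one
     relation. *)
  assert (h2 : (RtoC (1 / 2) + RtoC (1 / 2) = RtoC 1)%C) by (rewrite <- RtoC_plus; f_equal; field).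
  assert (half : forall x y z : C, (x = RtoC (1 / 2) * (y - z))%C -> Cmod x = Cmod (y - z) / 2).
  { intros x y z ->. apply Cmod_half. }
  assert (dbl : forall x : C, x = (RtoC (1 / 2) * x + RtoC (1 / 2) * x)%C).
  { intros x. rewrite <- Cmult_plus_distr_r, h2. ring. }
  assert (E1 : (m1 - a = RtoC (1 / 2) * (b - a))%C) by (unfold m1, seg; ring).
  assert (E2 : (m2 - b = RtoC (1 / 2) * (c - b))%C) by (unfold m2, seg; ring).
  assert (E3 : (m3 - c = RtoC (1 / 2) * (a - c))%C) by (unfold m3, seg; ring).
  assert (hh : forall x : C, (x - RtoC (1 / 2) * x = RtoC (1 / 2) * x)%C).
  { intros x. rewrite (dbl x) at 1. ring. }
  assert (F1 : (b - m1 = RtoC (1 / 2) * (b - a))%C).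
  { rewrite <- hh. unfold m1, seg. ring. }
  assert (F2 : (c - m2 = RtoC (1 / 2) * (c - b))%C).
  { rewrite <- hh. unfold m2, seg. ring. }
  assert (F3 : (a - m3 = RtoC (1 / 2) * (a - c))%C).
  { rewrite <- hh. unfold m3, seg. ring. }
  assert (G1 : (m2 - m1 = RtoC (1 / 2) * (c - a))%C).
  { replace (m2 - m1)%C with ((b - m1) + (m2 - b))%C by ring. rewrite F1, E2. ring. }
  assert (G2 : (m3 - m2 = RtoC (1 / 2) * (a - b))%C).
  { replace (m3 - m2)%C with ((c - m2) + (m3 - c))%C by ring. rewrite F2, E3. ring. }
  assert (G3 : (m1 - m3 = RtoC (1 / 2) * (b - c))%C).
  { replace (m1 - m3)%C with ((a - m3) + (m1 - a))%C by ring. rewrite F3, E1. ring. }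
  assert (sym : forall x y : C, Cmod (x - y) = Cmod (y - x)).
  { intros x y. rewrite <- Cmod_opp. f_equal. ring. }
  pose proof (half _ _ _ E1) as e1. pose proof (half _ _ _ E2) as e2.
  pose proof (half _ _ _ E3) as e3. pose proof (half _ _ _ F1) as f1.
  pose proof (half _ _ _ F2) as f2. pose proof (half _ _ _ F3) as f3.
  pose proof (half _ _ _ G1) as g1. pose proof (half _ _ _ G2) as g2.
  pose proof (half _ _ _ G3) as g3.
  rewrite (sym c a) in g1. rewrite (sym a b) in g2. rewrite (sym b c) in g3.
  pose proof (Cmod_ge_0 (b - a)). pose proof (Cmod_ge_0 (c - b)). pose proof (Cmod_ge_0 (a - c)).
  destruct (Rle_dec (Cmod (tri_int g a b c) / 4) (Cmod (tri_int g a m1 m3))) as [T1 | T1].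
  { exists a, m1, m3. repeat (split; [assumption|]). unfold perimeter.
    rewrite (sym m3 m1), e1, f3, g3. split; [lra|]. split; [|exact T1].
    replace (a - a)%C with (RtoC 0) by ring. rewrite Cmod_0. lra. }
  destruct (Rle_dec (Cmod (tri_int g a b c) / 4) (Cmod (tri_int g m1 b m2))) as [T2 | T2].
  { exists m1, b, m2. repeat (split; [assumption|]). unfold perimeter.
    rewrite (sym m1 m2), e1, f1, e2, g1. split; [lra|]. split; [lra|exact T2]. }
  destruct (Rle_dec (Cmod (tri_int g a b c) / 4) (Cmod (tri_int g m3 m2 c))) as [T3 | T3].
  { exists m3, m2, c. repeat (split; [assumption|]). unfold perimeter.
    rewrite (sym m2 m3), (sym m3 a), f3, e3, f2, g2. split; [lra|]. split; [lra|exact T3]. }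
  (* The other three pieces are below a quarter, so the triangle inequality forces the middle one to
     be at least a quarter. *)
  exists m1, m2, m3. repeat (split; [assumption|]). unfold perimeter.
  rewrite g1, g2, g3, e1. split; [lra|]. split; [lra|].
  pose proof (Cmod_triangle (tri_int g a m1 m3 + tri_int g m1 b m2)%C
                (tri_int g m3 m2 c + tri_int g m1 m2 m3)%C) as t0.
  pose proof (Cmod_triangle (tri_int g a m1 m3) (tri_int g m1 b m2)).
  pose proof (Cmod_triangle (tri_int g m3 m2 c) (tri_int g m1 m2 m3)).
  rewrite <- Sum in t0. lra.
Qed.

(** The intervals of radius [2 * M / 2 ^ n] around [x n] are nested, because the radius drops by
    [M / 2 ^ n], exactly the permitted step. The limit is the supremum of their left endpoints. *)
Lemma geometric_cauchy (x : nat -> R) (M : R) :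
  (forall n, Rabs (x (S n) - x n) <= M / 2 ^ n) ->
  exists l, forall n, Rabs (x n - l) <= 2 * M / 2 ^ n.
Proof.
  intros H.
  assert (St : forall n, x n - 2 * M / 2 ^ n <= x (S n) - 2 * M / 2 ^ S n /\
                  x (S n) + 2 * M / 2 ^ S n <= x n + 2 * M / 2 ^ n).
  { intros n. specialize (H n). apply Rabs_le_between in H.
    assert (P : 0 < 2 ^ n) by (apply pow_lt; lra).
    replace (2 * M / 2 ^ S n) with (M / 2 ^ n) by (simpl; field; lra).
    replace (2 * M / 2 ^ n) with (M / 2 ^ n + M / 2 ^ n) by (field; lra). lra. }
  assert (Mo : forall n k, x n - 2 * M / 2 ^ n <= x (n + k)%nat - 2 * M / 2 ^ (n + k) /\
                  x (n + k)%nat + 2 * M / 2 ^ (n + k) <= x n + 2 * M / 2 ^ n).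
  { intros n k. induction k as [|k IH].
    - rewrite Nat.add_0_r. lra.
    - rewrite Nat.add_succ_r. specialize (St (n + k)%nat). lra. }
  assert (Po : forall n, 0 <= 2 * M / 2 ^ n).
  { intros n. specialize (H n). pose proof (Rabs_pos (x (S n) - x n)).
    replace (2 * M / 2 ^ n) with (2 * (M / 2 ^ n)) by (unfold Rdiv; ring). lra. }
  assert (Cr : forall n m, x n - 2 * M / 2 ^ n <= x m + 2 * M / 2 ^ m).
  { intros n m. pose proof (proj1 (Mo n m)). pose proof (proj2 (Mo m n)) as Q.
    rewrite (Nat.add_comm m n) in Q. specialize (Po (n + m)%nat). lra. }
  destruct (completeness (fun r => exists n, r = x n - 2 * M / 2 ^ n)) as [l [Hub Hlub]].
  - exists (x 0%nat + 2 * M / 2 ^ 0). intros r [n ->]. apply Cr.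
  - exists (x 0%nat - 2 * M / 2 ^ 0), 0%nat. reflexivity.
  - exists l. intros n. apply Rabs_le_between.
    pose proof (Hub _ (ex_intro _ n eq_refl)).
    assert (l <= x n + 2 * M / 2 ^ n) by (apply Hlub; intros r [m ->]; apply Cr).
    lra.
Qed.

(** The constant [4] adds the two errors of size [2 * M / 2 ^ n] in the real and imaginary parts. *)
Lemma geometric_cauchy_C (x : nat -> C) (M : R) :
  (forall n, Cmod (x (S n) - x n) <= M / 2 ^ n) ->
  exists l : C, forall n, Cmod (x n - l) <= 4 * M / 2 ^ n.
Proof.
  intros H.
  assert (L : forall n, Rabs (fst (x (S n)) - fst (x n)) <= M / 2 ^ n /\
                        Rabs (snd (x (S n)) - snd (x n)) <= M / 2 ^ n).
  { intros n. pose proof (Rmax_Cmod (x (S n) - x n)%C) as R. simpl in R.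
    specialize (H n). unfold Rminus in *.
    split; eapply Rle_trans; try apply H; eapply Rle_trans; try apply R;
      [apply Rmax_l | apply Rmax_r]. }
  destruct (geometric_cauchy (fun n => fst (x n)) M) as [p Hp]; [intros n; apply L|].
  destruct (geometric_cauchy (fun n => snd (x n)) M) as [q Hq]; [intros n; apply L|].
  exists (p, q). intros n. specialize (Hp n). specialize (Hq n).
  replace (x n - (p, q))%C with (RtoC (fst (x n) - p) + Ci * RtoC (snd (x n) - q))%C.
  - eapply Rle_trans; [apply Cmod_triangle|]. rewrite Cmod_mult, Cmod_Ci, !Cmod_R.
    replace (4 * M / 2 ^ n) with (2 * M / 2 ^ n + 2 * M / 2 ^ n) by (unfold Rdiv; ring). lra.
  - destruct (x n) as [u v]. unfold RtoC, Ci, Cplus, Cmult, Cminus, Copp; simpl.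
    apply injective_projections; simpl; ring.
Qed.

(** The nested triangles shrink to a point [p], which closedness puts in [K]. Near [p] the function
    is affine up to [eps] times the distance, so the integral over the [n]-th triangle is at most
    [eps] times a multiple of [4^(-n)], while it carries at least [4^(-n)] of the original
    integral. *)
Lemma goursat (g : C -> C) (K : C -> Prop) (a b c : C) :
  convex K ->
  (forall p, (forall e, 0 < e -> exists w, K w /\ Cmod (w - p) < e) -> K p) ->
  (forall w, K w -> @ex_derive C_AbsRing C_NormedModule g w) ->
  K a -> K b -> K c -> tri_int g a b c = RtoC 0.
Proof.
  intros HK Hcl Hg Ka Kb Kc.
  assert (Hc : forall w, K w -> @continuous C_UniformSpace C_UniformSpace g w).
  { intros w Kw. destruct (Hg w Kw) as [l Hl]. apply (is_derive_C_continuous g w l Hl). }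
  assert (CS : forall x y, K x -> K y -> continuous_on_seg g x y).
  { intros x y Kx Ky t Ht. apply Hc, HK; assumption. }
  set (inK := fun t : C * C * C => K (fst (fst t)) /\ K (snd (fst t)) /\ K (snd t)).
  set (T := fun t : C * C * C => Cmod (tri_int g (fst (fst t)) (snd (fst t)) (snd t))).
  set (per := fun t : C * C * C => perimeter (fst (fst t)) (snd (fst t)) (snd t)).
  (* Choice needs a successor for every triple; a triple not in [K] is sent to itself, where nothing
     is claimed. *)
  destruct (functional_choice (fun t t' => inK t ->
    inK t' /\ per t' = per t / 2 /\ Cmod (fst (fst t') - fst (fst t)) <= per t /\ T t / 4 <= T t'))
    as [next Hnext].
  { intros t. destruct (classic (inK t)) as [[k1 [k2 k3]] | N].
    - destruct (tri_int_quarter g K _ _ _ HK Hc k1 k2 k3)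
        as (a' & b' & c' & k1' & k2' & k3' & Hp & Hd & Ht).
      exists (a', b', c'). intros _. repeat split; assumption.
    - exists t. tauto. }
  set (tr := fun n => Nat.iter n next (a, b, c)).
  set (P := perimeter a b c).
  assert (Inv : forall n, inK (tr n) /\ per (tr n) = P / 2 ^ n /\
      Cmod (tri_int g a b c) / 4 ^ n <= T (tr n)).
  { intros n. induction n as [|n [IK [IP IT]]].
    - simpl. split; [repeat split; assumption|]. unfold per, T, P; simpl. split; lra.
    - destruct (Hnext (tr n) IK) as (NK & NP & _ & NT). change (tr (S n)) with (next (tr n)).
      split; [exact NK|].
      assert (0 < 2 ^ n) by (apply pow_lt; lra). assert (0 < 4 ^ n) by (apply pow_lt; lra). split.
      + rewrite NP, IP. simpl. field. lra.
      + replace (Cmod (tri_int g a b c) / 4 ^ S n) with (Cmod (tri_int g a b c) / 4 ^ n / 4)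
          by (simpl; field; lra). lra. }
  destruct (geometric_cauchy_C (fun n => fst (fst (tr n))) P) as [p Hp].
  { intros n. destruct (Inv n) as (IK & IP & _). rewrite <- IP.
    apply (Hnext (tr n) IK). }
  assert (P0 : 0 <= P).
  { unfold P, perimeter. pose proof (Cmod_ge_0 (b - a)). pose proof (Cmod_ge_0 (c - b)).
    pose proof (Cmod_ge_0 (a - c)). lra. }
  (* The [5] is [4 + 1]: the first vertex lies within [4 * P / 2 ^ n] of [p], and every point of the
     triangle's boundary within [P / 2 ^ n] of that vertex. *)
  assert (Small : forall e, 0 < e -> exists n, 5 * P / 2 ^ n < e).
  { intros e He. destruct (pow_lt_1_zero (1 / 2)) with (y := e / (5 * P + 1)) as [N HN].
    - rewrite Rabs_right; lra.
    - apply Rdiv_lt_0_compat; lra.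
    - exists N. specialize (HN N (le_n N)).
      assert (P2 : 0 < 2 ^ N) by (apply pow_lt; lra).
      replace ((1 / 2) ^ N) with (/ 2 ^ N) in HN
        by (rewrite <- pow_inv; f_equal; field).
      rewrite Rabs_right in HN by (apply Rle_ge, Rlt_le, Rinv_0_lt_compat, P2).
      apply (Rmult_lt_compat_r (5 * P + 1)) in HN; [|lra].
      replace (e / (5 * P + 1) * (5 * P + 1)) with e in HN by (field; lra).
      unfold Rdiv. pose proof (Rinv_0_lt_compat _ P2). nra. }
  assert (Kp : K p).
  { apply Hcl. intros e He. destruct (Small e He) as [n Hn].
    exists (fst (fst (tr n))). split; [apply (Inv n)|].
    eapply Rle_lt_trans; [apply Hp|]. eapply Rle_lt_trans; [|exact Hn].
    apply Rmult_le_compat_r; [left; apply Rinv_0_lt_compat, pow_lt; lra|lra]. }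
  destruct (Hg p Kp) as [l Hl].
  apply Cmod_eq_0. apply Rle_antisym; [|apply Cmod_ge_0].
  apply le_epsilon. intros e He. rewrite Rplus_0_l.
  (* After multiplication by [4 ^ n] the final bound is [5 * P * P] times this accuracy; the [+ 1]
     covers [P = 0]. *)
  assert (He' : 0 < e / (5 * P * P + 1)) by (apply Rdiv_lt_0_compat; nra).
  destruct (proj1 (is_derive_C_eps g p l) Hl _ He') as [d [Hd Hgd]].
  destruct (Small d Hd) as [n Hn].
  destruct (Inv n) as (IK & IP & IT). specialize (Hp n). simpl in Hp.
  revert IK IP IT Hp. unfold inK, T, per.
  destruct (tr n) as [[x y] z]. simpl. intros (Kx & Ky & Kz) IP IT Hp.
  assert (P2 : 0 < 2 ^ n) by (apply pow_lt; lra).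
  set (eps := e / (5 * P * P + 1)) in *. set (r := 5 * P / 2 ^ n) in *.
  assert (Rr : r = 4 * P / 2 ^ n + P / 2 ^ n) by (unfold r; field; lra).
  pose proof (Cmod_ge_0 (y - x)) as q1. pose proof (Cmod_ge_0 (z - y)) as q2.
  pose proof (Cmod_ge_0 (x - z)) as q3. unfold perimeter in IP.
  assert (Near : forall w, Cmod (w - x) <= P / 2 ^ n ->
     Cmod (g w - g p - l * (w - p)) <= eps * r).
  { intros w Hw.
    assert (Cmod (w - p) <= r).
    { replace (w - p)%C with ((w - x) + (x - p))%C by ring.
      eapply Rle_trans; [apply Cmod_triangle|]. lra. }
    eapply Rle_trans; [apply Hgd; lra|]. apply Rmult_le_compat_l; lra. }
  assert (sc : forall t u : C, forall s, 0 <= s <= 1 -> Cmod (RtoC s * (t - u)) <= Cmod (t - u)).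
  { intros t u s Hs. rewrite Cmod_mult, Cmod_R, Rabs_right by lra.
    pose proof (Cmod_ge_0 (t - u)). nra. }
  pose proof (seg_int_affine_approx g x y p (g p) l (eps * r) (CS _ _ Kx Ky)) as A1.
  pose proof (seg_int_affine_approx g y z p (g p) l (eps * r) (CS _ _ Ky Kz)) as A2.
  pose proof (seg_int_affine_approx g z x p (g p) l (eps * r) (CS _ _ Kz Kx)) as A3.
  assert (sym : forall x y : C, Cmod (x - y) = Cmod (y - x)).
  { intros u v. rewrite <- Cmod_opp. f_equal. ring. }
  specialize (A1 ltac:(intros t Ht; apply Near; unfold seg;
    replace (x + RtoC t * (y - x) - x)%C with (RtoC t * (y - x))%C by ring;
    eapply Rle_trans; [apply sc, Ht | lra])).
  specialize (A2 ltac:(intros t Ht; apply Near; unfold seg;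
    replace (y + RtoC t * (z - y) - x)%C with ((y - x) + RtoC t * (z - y))%C by ring;
    eapply Rle_trans; [apply Cmod_triangle|];
    pose proof (sc z y t Ht); lra)).
  specialize (A3 ltac:(intros t Ht; apply Near; unfold seg;
    replace (z + RtoC t * (x - z) - x)%C with ((1 - RtoC t) * (z - x))%C by ring;
    rewrite <- RtoC_minus; eapply Rle_trans; [apply sc; lra | rewrite sym; lra])).
  match type of A1 with Cmod ?u <= _ => set (U1 := u) in A1 end.
  match type of A2 with Cmod ?u <= _ => set (U2 := u) in A2 end.
  match type of A3 with Cmod ?u <= _ => set (U3 := u) in A3 end.
  (* The affine parts telescope around the triangle, so its integral is the sum of the three
     remainders. *)
  assert (TT : tri_int g x y z = (U1 + U2 + U3)%C) by (unfold tri_int, U1, U2, U3; ring).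
  assert (TB : Cmod (tri_int g x y z) <= eps * r * (P / 2 ^ n)).
  { rewrite TT, <- IP. eapply Rle_trans; [apply Cmod_triangle|].
    pose proof (Cmod_triangle U1 U2). lra. }
  assert (P4 : 4 ^ n = 2 ^ n * 2 ^ n) by (rewrite <- Rpow_mult_distr; f_equal; lra).
  assert (B : Cmod (tri_int g a b c) / 4 ^ n * 4 ^ n <= eps * r * (P / 2 ^ n) * 4 ^ n).
  { apply Rmult_le_compat_r; [left; apply pow_lt; lra | lra]. }
  replace (Cmod (tri_int g a b c) / 4 ^ n * 4 ^ n) with (Cmod (tri_int g a b c)) in B
    by (field; apply Rgt_not_eq, pow_lt; lra).
  replace (eps * r * (P / 2 ^ n) * 4 ^ n) with (eps * (5 * P * P)) in B
    by (rewrite P4; unfold r; field; lra).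
  assert (eps * (5 * P * P + 1) = e) by (unfold eps; field; nra).
  nra.
Qed.

Lemma Cmod_seg_le (a b : C) (t r : R) :
  0 <= t <= 1 -> Cmod a <= r -> Cmod b <= r -> Cmod (seg a b t) <= r.
Proof.
  intros Ht Ha Hb. unfold seg.
  replace (a + RtoC t * (b - a))%C with (RtoC (1 - t) * a + RtoC t * b)%C
    by (rewrite RtoC_minus; ring).
  eapply Rle_trans; [apply Cmod_triangle|].
  rewrite !Cmod_mult, !Cmod_R, !Rabs_right by lra. nra.
Qed.

Lemma convex_disk : convex in_disk.
Proof.
  intros x y t Hx Hy Ht. unfold in_disk in *.
  apply Rle_lt_trans with (Rmax (Cmod x) (Cmod y)).
  - apply Cmod_seg_le; [exact Ht | apply Rmax_l | apply Rmax_r].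
  - apply Rmax_lub_lt; assumption.
Qed.

(** * Primitives of functions holomorphic off the origin *)

(** The Euclidean inner product, the real part of [conj z * w]. It serves to cut out half-planes
    and, later, to replace a complex function along a ray by a real one. *)
Definition dot (z w : C) : R := fst z * fst w + snd z * snd w.

Lemma dot_le_Cmod (z w : C) : Rabs (dot z w) <= Cmod z * Cmod w.
Proof.
  rewrite <- (Cmod_conj z), <- Cmod_mult.
  eapply Rle_trans; [|apply re_le_Cmod]. right. f_equal. unfold dot. simpl. ring.
Qed.

Lemma dot_self (z : C) : dot z z = Cmod z * Cmod z.
Proof.
  pose proof (Cmod2_alt z) as H. unfold Re, Im in H. unfold dot. nra.
Qed.

(* The region meets neither the origin nor the unit circle, so Goursat applies on it to a
   function that is only continuous at the origin. *)
Lemma tri_int_half_plane (G : C -> C) (z a b c : C) (r d : R) :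
  (forall w, in_disk w -> w <> RtoC 0 -> @ex_derive C_AbsRing C_NormedModule G w) ->
  r < 1 -> 0 < d ->
  (forall w, w = a \/ w = b \/ w = c -> Cmod w <= r /\ d <= dot z w) ->
  tri_int G a b c = RtoC 0.
Proof.
  intros HG Hr Hd H. apply goursat with (K := fun w => Cmod w <= r /\ d <= dot z w); auto.
  - intros x y t [X1 X2] [Y1 Y2] Ht. split; [apply Cmod_seg_le; assumption|].
    replace (dot z (seg x y t)) with ((1 - t) * dot z x + t * dot z y).
    + nra.
    + unfold dot, seg. simpl. ring.
  - intros p Hp. split.
    + apply le_epsilon. intros e He. destruct (Hp e He) as [w [[W _] Hw]].
      replace p with (w + - (w - p))%C by ring.
      eapply Rle_trans; [apply Cmod_triangle|]. rewrite Cmod_opp. lra.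
    + apply le_epsilon. intros e He. pose proof (Cmod_ge_0 z).
      destruct (Hp (e / (Cmod z + 1))) as [w [[_ W] Hw]]; [apply Rdiv_lt_0_compat; lra|].
      pose proof (dot_le_Cmod z (w - p)) as D. apply Rabs_le_between in D.
      assert (dot z (w - p) = dot z w - dot z p) by (unfold dot; simpl; ring).
      apply (Rmult_lt_compat_r (Cmod z + 1)) in Hw; [|lra].
      replace (e / (Cmod z + 1) * (Cmod z + 1)) with e in Hw by (field; lra).
      pose proof (Cmod_ge_0 (w - p)). nra.
  - intros w [W1 W2]. apply HG.
    + unfold in_disk. lra.
    + intros ->. unfold dot in W2. simpl in W2. lra.
Qed.

Section Primitive.

Variable G : C -> C.
Hypothesis G_cont : forall w, in_disk w -> @continuous C_UniformSpace C_UniformSpace G w.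
Hypothesis G_deriv :
  forall w, in_disk w -> w <> RtoC 0 -> @ex_derive C_AbsRing C_NormedModule G w.

Lemma continuous_on_seg_disk (a b : C) : in_disk a -> in_disk b -> continuous_on_seg G a b.
Proof. intros Ha Hb t Ht. apply G_cont, convex_disk; assumption. Qed.

Lemma in_disk_0 : in_disk (RtoC 0).
Proof. unfold in_disk. rewrite Cmod_0. lra. Qed.

Lemma seg_int_const_approx (a b : C) (c : C) (M : R) :
  in_disk a -> in_disk b ->
  (forall t, 0 <= t <= 1 -> Cmod (G (seg a b t) - c) <= M) ->
  Cmod (seg_int G a b - c * (b - a)) <= M * Cmod (b - a).
Proof.
  intros Ha Hb H.
  pose proof (seg_int_affine_approx G a b 0 c 0 M (continuous_on_seg_disk a b Ha Hb)) as A.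
  replace (seg_int G a b - c * (b - a))%C
    with (seg_int G a b - (c * (b - a) + RtoC 0 * RtoC (1 / 2) *
           ((b - RtoC 0) * (b - RtoC 0) - (a - RtoC 0) * (a - RtoC 0))))%C by ring.
  apply A. intros t Ht. replace (_ - _)%C with (G (seg a b t) - c)%C by ring. apply H, Ht.
Qed.

(** Scaling by a small [s] cuts off the triangle [0, z', v']; the remaining quadrilateral is split
    along the diagonal from [z] to [v']. The closeness of [v] to [z] gives [dot z v >= |z|^2 / 2],
    so a half-plane separates the quadrilateral from the origin and Goursat's theorem kills both of
    its triangles. *)
Lemma tri_int_origin (z v : C) :
  in_disk z -> in_disk v -> z <> RtoC 0 -> Cmod (v - z) <= Cmod z / 2 ->
  tri_int G 0 z v = RtoC 0.
Proof.
  intros Hz Hv Nz Hvz.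
  pose proof (proj1 (Cmod_gt_0 z) Nz) as Pz.
  apply Cmod_eq_0. apply Rle_antisym; [|apply Cmod_ge_0].
  apply le_epsilon. intros e He. rewrite Rplus_0_l.
  (* A fixed accuracy [1] is enough here: the smallness comes from the perimeter [s * P] of the
     cut-off triangle. *)
  destruct (proj1 (continuous_C_eps G 0) (G_cont 0 in_disk_0) 1 Rlt_0_1) as [d [Hd Gd]].
  set (P := perimeter 0 z v).
  assert (HP : 0 <= P).
  { unfold P, perimeter. pose proof (Cmod_ge_0 (z - 0)). pose proof (Cmod_ge_0 (v - z)).
    pose proof (Cmod_ge_0 (0 - v)). lra. }
  assert (Hs : exists s, 0 < s < 1 /\ s < d /\ s * P <= e).
  { exists (Rmin (1 / 2) (Rmin (d / 2) (e / (P + 1)))).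
    assert (Q : 0 < e / (P + 1)) by (apply Rdiv_lt_0_compat; lra).
    set (s := Rmin _ _).
    assert (s <= 1 / 2) by apply Rmin_l.
    assert (S2 : s <= Rmin (d / 2) (e / (P + 1))) by apply Rmin_r.
    assert (s <= d / 2) by (eapply Rle_trans; [exact S2 | apply Rmin_l]).
    assert (S3 : s <= e / (P + 1)) by (eapply Rle_trans; [exact S2 | apply Rmin_r]).
    assert (0 < s) by (repeat apply Rmin_glb_lt; lra).
    apply (Rmult_le_compat_r (P + 1)) in S3; [|lra].
    replace (e / (P + 1) * (P + 1)) with e in S3 by (field; lra).
    repeat split; nra. }
  destruct Hs as (s & Hs & Hsd & HsP).
  set (z' := (RtoC s * z)%C). set (v' := (RtoC s * v)%C).
  assert (Ms : forall u, Cmod (RtoC s * u) = s * Cmod u).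
  { intros u. rewrite Cmod_mult, Cmod_R, Rabs_right; lra. }
  pose proof (Cmod_ge_0 v) as Pv.
  unfold in_disk in Hz, Hv.
  assert (Hz' : in_disk z') by (unfold in_disk, z'; rewrite Ms; nra).
  assert (Hv' : in_disk v') by (unfold in_disk, v'; rewrite Ms; nra).
  pose proof in_disk_0 as H0.
  assert (Dv : Cmod z * Cmod z / 2 <= dot z v).
  { pose proof (dot_le_Cmod z (v - z)) as D. apply Rabs_le_between in D.
    assert (dot z v = dot z z + dot z (v - z)) by (unfold dot; simpl; ring).
    rewrite dot_self in H. nra. }
  assert (Dz := dot_self z).
  assert (Dz' : dot z z' = s * dot z z) by (unfold dot, z'; simpl; ring).
  assert (Dv' : dot z v' = s * dot z v) by (unfold dot, v'; simpl; ring).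
  assert (Zp : 0 < Cmod z * Cmod z) by nra.
  (* Among the four vertices the inner product with [z] is smallest at the scaled ones, where it is
     still at least [s * |z|^2 / 2]. *)
  assert (Far : forall a b c, (forall w, w = a \/ w = b \/ w = c -> w = z \/ w = v \/ w = z' \/ w = v') ->
     tri_int G a b c = RtoC 0).
  { intros a b c Habc.
    apply tri_int_half_plane with (z := z) (r := Rmax (Cmod z) (Cmod v))
      (d := s * (Cmod z * Cmod z / 2)); auto.
    - apply Rmax_lub_lt; assumption.
    - nra.
    - pose proof (Rmax_l (Cmod z) (Cmod v)). pose proof (Rmax_r (Cmod z) (Cmod v)).
      intros w Hw. destruct (Habc w Hw) as [-> | [-> | [-> | ->]]]; (split; [|nra]); auto.
      + unfold z'. rewrite Ms. nra.
      + unfold v'. rewrite Ms. nra. }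
  assert (CS := continuous_on_seg_disk).
  assert (Dec : tri_int G 0 z v
     = (tri_int G 0 z' v' + (tri_int G z' z v' + tri_int G z v v'))%C).
  { unfold tri_int.
    rewrite (seg_int_split G 0 z s), (seg_int_split G v 0 (1 - s)) by (try apply CS; auto; lra).
    replace (seg 0 z s) with z' by (unfold seg, z'; ring).
    replace (seg v 0 (1 - s)) with v' by (unfold seg, v'; rewrite RtoC_minus; ring).
    rewrite (seg_int_swap G z' v'), (seg_int_swap G z v') by (apply CS; auto). ring. }
  rewrite Dec, (Far z' z v'), (Far z v v'), !Cplus_0_r by (intros; tauto).
  assert (Near : forall a b, Cmod a < d -> Cmod b < d -> in_disk a -> in_disk b ->
    Cmod (seg_int G a b - G 0 * (b - a)) <= 1 * Cmod (b - a)).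
  { intros a b Ha Hb Da Db. apply seg_int_const_approx; auto. intros t Ht. left. apply Gd.
    replace (seg a b t - 0)%C with (seg a b t) by ring.
    eapply Rle_lt_trans; [apply Cmod_seg_le; [exact Ht | apply Rmax_l | apply Rmax_r]|].
    apply Rmax_lub_lt; assumption. }
  assert (z'd : Cmod z' < d) by (unfold z'; rewrite Ms; nra).
  assert (v'd : Cmod v' < d) by (unfold v'; rewrite Ms; nra).
  assert (d0 : Cmod 0 < d) by (rewrite Cmod_0; lra).
  pose proof (Near _ _ d0 z'd H0 Hz') as N1. pose proof (Near _ _ z'd v'd Hz' Hv') as N2.
  pose proof (Near _ _ v'd d0 Hv' H0) as N3.
  match type of N1 with Cmod ?u <= _ => set (U1 := u) in N1 end.
  match type of N2 with Cmod ?u <= _ => set (U2 := u) in N2 end.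
  match type of N3 with Cmod ?u <= _ => set (U3 := u) in N3 end.
  replace (tri_int G 0 z' v') with (U1 + U2 + U3)%C by (unfold tri_int, U1, U2, U3; ring).
  eapply Rle_trans; [apply Cmod_triangle|]. pose proof (Cmod_triangle U1 U2).
  replace (z' - 0)%C with (RtoC s * (z - 0))%C in N1 by (unfold z'; ring).
  replace (v' - z')%C with (RtoC s * (v - z))%C in N2 by (unfold v', z'; ring).
  replace (0 - v')%C with (RtoC s * (0 - v))%C in N3 by (unfold v'; ring).
  rewrite Ms in N1, N2, N3. unfold P, perimeter in HsP. lra.
Qed.

Lemma seg_int_origin_sub (z v : C) :
  in_disk z -> in_disk v -> (z <> RtoC 0 -> Cmod (v - z) <= Cmod z / 2) ->
  (seg_int G 0 v - seg_int G 0 z = seg_int G z v)%C.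
Proof.
  intros Hz Hv H. pose proof in_disk_0 as H0.
  destruct (Ceq_dec z 0) as [-> | N].
  - rewrite seg_int_refl. ring.
  - pose proof (tri_int_origin z v Hz Hv N (H N)) as T. unfold tri_int in T.
    rewrite (seg_int_swap G 0 v) in T by (apply continuous_on_seg_disk; auto).
    replace (seg_int G 0 v - seg_int G 0 z)%C
      with (seg_int G z v - (seg_int G 0 z + seg_int G z v + - seg_int G 0 v))%C by ring.
    rewrite T. ring.
Qed.

Lemma is_derive_seg_int (z : C) :
  in_disk z -> @is_derive C_AbsRing C_NormedModule (seg_int G 0) z (G z).
Proof.
  intros Hz. apply is_derive_C_eps. intros e He.
  destruct (proj1 (continuous_C_eps G z) (G_cont z Hz) e He) as [d [Hd Gd]].
  (* The radius keeps [w] within the continuity range, in the disk, and close enough to [z] for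
     [tri_int_origin]. The last demand is void at [z = 0], where the two segments from the origin
     differ by a degenerate one. *)
  assert (Hr : exists r, 0 < r /\ r <= d /\ r <= 1 - Cmod z /\ (z <> RtoC 0 -> r <= Cmod z / 2)).
  { unfold in_disk in Hz. destruct (Ceq_dec z 0) as [-> | N].
    - exists (Rmin d (1 - Cmod 0)). split; [apply Rmin_glb_lt; lra|].
      split; [apply Rmin_l|]. split; [apply Rmin_r|]. intros K; contradiction K; reflexivity.
    - pose proof (proj1 (Cmod_gt_0 z) N).
      exists (Rmin d (Rmin (1 - Cmod z) (Cmod z / 2))).
      pose proof (Rmin_l d (Rmin (1 - Cmod z) (Cmod z / 2))).
      pose proof (Rmin_r d (Rmin (1 - Cmod z) (Cmod z / 2))).
      pose proof (Rmin_l (1 - Cmod z) (Cmod z / 2)).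
      pose proof (Rmin_r (1 - Cmod z) (Cmod z / 2)).
      split; [repeat apply Rmin_glb_lt; lra|]. repeat split; intros; lra. }
  destruct Hr as (r & Hr & Hrd & Hr1 & Hrz).
  exists r. split; [exact Hr|]. intros w Hw.
  assert (Dw : in_disk w).
  { unfold in_disk. replace w with ((w - z) + z)%C by ring.
    eapply Rle_lt_trans; [apply Cmod_triangle|]. lra. }
  rewrite seg_int_origin_sub; auto.
  - apply seg_int_const_approx; auto. intros t Ht. left. apply Gd.
    replace (seg z w t - z)%C with (RtoC t * (w - z))%C by (unfold seg; ring).
    rewrite Cmod_mult, Cmod_R, Rabs_right by lra. pose proof (Cmod_ge_0 (w - z)). nra.
  - intros N. specialize (Hrz N). lra.
Qed.

End Primitive.

(** * Bloch functions and the Cesaro operator *)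

Lemma bloch_weight_le (alpha : R) (f : C -> C) (z : C) :
  bloch alpha f -> in_disk z -> bloch_weight alpha f z <= real (bloch_norm alpha f).
Proof.
  intros [_ Hf] Hz. unfold is_finite in Hf.
  pose proof (proj1 (Lub_Rbar_correct (fun r => exists z, in_disk z /\ r = bloch_weight alpha f z))) as H.
  specialize (H _ (ex_intro _ z (conj Hz eq_refl))).
  fold (bloch_norm alpha f) in H. rewrite <- Hf in H. exact H.
Qed.

(** The supremum lives in [Rbar]: the weight at [0] excludes minus infinity, and the bound [M]
    excludes plus infinity. *)
Lemma bloch_norm_bounded (alpha : R) (f : C -> C) (M : R) :
  (forall z, in_disk z -> bloch_weight alpha f z <= M) ->
  is_finite (bloch_norm alpha f) /\ real (bloch_norm alpha f) <= M.
Proof.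
  intros H. unfold bloch_norm.
  destruct (Lub_Rbar_correct (fun r => exists z, in_disk z /\ r = bloch_weight alpha f z)) as [U L].
  specialize (L (Finite M)).
  specialize (U _ (ex_intro _ (RtoC 0) (conj in_disk_0 eq_refl))).
  destruct (Lub_Rbar _) as [x | |]; simpl in *.
  - split; [reflexivity|]. apply L. intros r [z [Hz ->]]. apply H, Hz.
  - contradiction L. intros r [z [Hz ->]]. apply H, Hz.
  - contradiction.
Qed.

Lemma is_derive_dot_ray (f : C -> C) (u z l : C) (t : R) :
  @is_derive C_AbsRing C_NormedModule f (RtoC t * z)%C l ->
  is_derive (fun s : R => dot u (f (RtoC s * z)%C)) t (dot u (l * z)%C).
Proof.
  intros H. split; [apply is_linear_scal_l|].
  intros x Hx.
  apply (@is_filter_lim_locally_unique R_AbsRing R_NormedModule) in Hx. subst x. intros eps.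
  pose proof (Cmod_ge_0 u) as Pu. pose proof (Cmod_ge_0 z) as Pz.
  (* Passing to the ray and pairing with [u] multiplies the remainder by at most [|z|] and [|u|];
     the [+ 1] keeps the divisor positive. *)
  assert (D0 : 0 < Cmod u * Cmod z + 1) by nra.
  assert (He : 0 < eps / (Cmod u * Cmod z + 1)) by (apply Rdiv_lt_0_compat; [apply cond_pos | lra]).
  destruct (proj1 (is_derive_C_eps f _ l) H _ He) as [d [Hd Hf]].
  assert (Hd' : 0 < d / (Cmod z + 1)) by (apply Rdiv_lt_0_compat; lra).
  exists (mkposreal _ Hd'). intros s Hs.
  change (Rabs (s - t) < d / (Cmod z + 1)) in Hs.
  change (Rabs ((dot u (f (RtoC s * z)%C) - dot u (f (RtoC t * z)%C)) - (s - t) * dot u (l * z)%C)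
    <= eps * Rabs (s - t)).
  assert (E : Cmod (RtoC s * z - RtoC t * z) = Rabs (s - t) * Cmod z).
  { rewrite <- Cmod_R, <- Cmod_mult, RtoC_minus. f_equal. ring. }
  apply (Rmult_lt_compat_r (Cmod z + 1)) in Hs; [|lra].
  replace (d / (Cmod z + 1) * (Cmod z + 1)) with d in Hs by (field; lra).
  pose proof (Rabs_pos (s - t)) as Ps.
  specialize (Hf (RtoC s * z)%C). rewrite E in Hf. specialize (Hf ltac:(nra)).
  set (D := (f (RtoC s * z) - f (RtoC t * z) - l * (RtoC s * z - RtoC t * z))%C) in Hf.
  replace (_ - _ - _) with (dot u D) by (unfold D, dot; simpl; ring).
  eapply Rle_trans; [apply dot_le_Cmod|].
  assert (Q : eps / (Cmod u * Cmod z + 1) * (Cmod u * Cmod z + 1) = eps) by (field; lra).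
  set (e' := eps / (Cmod u * Cmod z + 1)) in *.
  apply Rle_trans with (Cmod u * (e' * (Rabs (s - t) * Cmod z))).
  - apply Rmult_le_compat_l; assumption.
  - rewrite <- Q. assert (0 <= e' * Rabs (s - t)) by nra. nra.
Qed.

Lemma Rpower_le_base (x y a : R) : 0 < x <= y -> 0 <= a -> Rpower x a <= Rpower y a.
Proof. intros H Ha. apply Rle_Rpower_l; lra. Qed.

Lemma Rpower_1_minus (x a : R) : 0 < x -> Rpower x (1 - a) = x * Rpower x (- a).
Proof.
  intros Hx. unfold Rminus. rewrite Rpower_plus, Rpower_1; auto.
Qed.

(** [1 - |z| <= 1 - |z|^2], and a power with nonnegative exponent is monotone in its base. *)
Lemma bloch_deriv_bound (alpha M : R) (f : C -> C) (z : C) :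
  0 <= alpha -> in_disk z -> bloch_weight alpha f z <= M ->
  Cmod (C_derive f z) <= M * Rpower (1 - Cmod z) (- alpha).
Proof.
  intros Ha Hz H. unfold bloch_weight, cderiv, in_disk in *.
  pose proof (Cmod_ge_0 z). pose proof (Cmod_ge_0 (C_derive f z)).
  assert (P1 : Rpower (1 - Cmod z) alpha <= Rpower (1 - Cmod z ^ 2) alpha)
    by (apply Rpower_le_base; nra).
  rewrite Rpower_Ropp. pose proof (exp_pos (alpha * ln (1 - Cmod z))) as P.
  fold (Rpower (1 - Cmod z) alpha) in P.
  apply Rmult_le_reg_r with (Rpower (1 - Cmod z) alpha); [exact P|].
  replace (M * / Rpower (1 - Cmod z) alpha * Rpower (1 - Cmod z) alpha) with M by (field; lra).
  nra.
Qed.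

(* With c = min(1, alpha - 1), the function r (1 - r)^(1 - alpha) / c has derivative at least
   (1 - r)^(- alpha); it is compared with f along the ray through z. *)
Lemma bloch_growth (alpha M c : R) (f : C -> C) (z : C) :
  0 <= alpha -> 0 < c -> c <= 1 -> c <= alpha - 1 -> analytic_on_disk f -> f 0 = RtoC 0 ->
  (forall w, in_disk w -> bloch_weight alpha f w <= M) -> in_disk z ->
  Cmod (f z) <= M / c * (Cmod z * Rpower (1 - Cmod z) (1 - alpha)).
Proof.
  intros Ha Hc0 Hc1 Hca Hf Hf0 HM Hz.
  assert (M0 : 0 <= M).
  { specialize (HM 0 in_disk_0). eapply Rle_trans; [|exact HM].
    apply Rmult_le_pos; [left; apply exp_pos | apply Cmod_ge_0]. }
  set (r := Cmod z). set (m := Cmod (f z)).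
  pose proof (Cmod_ge_0 z) as Pr. pose proof (Cmod_ge_0 (f z)) as Pm. fold r in Pr. fold m in Pm.
  unfold in_disk in Hz. fold r in Hz.
  (* Pairing with the fixed vector [f z] makes the real function [h] go from [0] to [m * m], so the
     majorant [B] also carries a factor [m], cancelled at the end. The mean value theorem is applied
     to [h - B]. *)
  set (B := fun t => m * (M / c) * (t * r * Rpower (1 - t * r) (1 - alpha))).
  set (dB := fun t => m * (M / c) * (r * (Rpower (1 - t * r) (- alpha) * (1 - t * r + (alpha - 1) * (t * r))))).
  set (h := fun t => dot (f z) (f (RtoC t * z)%C)).
  set (dh := fun t => dot (f z) (C_derive f (RtoC t * z) * z)%C).
  assert (Dt : forall t, 0 <= t <= 1 -> in_disk (RtoC t * z)%C /\ Cmod (RtoC t * z) = t * r).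
  { intros t Ht. assert (E : Cmod (RtoC t * z) = t * r)
      by (rewrite Cmod_mult, Cmod_R, Rabs_right by lra; reflexivity).
    split; [unfold in_disk; rewrite E; nra | exact E]. }
  destruct (MVT_cor2 (fun t => h t - B t) (fun t => dh t - dB t) 0 1 Rlt_0_1) as (t & Et & Ht).
  { intros t Ht. apply is_derive_Reals. apply (is_derive_minus h B).
    - apply is_derive_dot_ray. apply C_derive_correct; [exact z|]. apply Hf, Dt, Ht.
    - unfold B. assert (0 < 1 - t * r) by nra.
      apply is_derive_ext with (fun t => m * (M / c) * (t * r * exp ((1 - alpha) * ln (1 - t * r))));
        [reflexivity|].
      unfold dB. auto_derive; [lra|].
      change (exp ((1 - alpha) * ln (1 + - (t * r)))) with (Rpower (1 - t * r) (1 - alpha)).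
      rewrite (Rpower_1_minus (1 - t * r) alpha) by lra. field. split; lra. }
  assert (Ht' : 0 <= t <= 1) by lra. destruct (Dt t Ht') as [D1 D2].
  assert (P : 0 < 1 - t * r) by nra.
  assert (Hle : dh t <= dB t).
  { apply Rle_trans with (m * (Cmod (C_derive f (RtoC t * z)) * r)).
    - unfold dh, m, r. rewrite <- Cmod_mult. eapply Rle_trans; [apply Rle_abs|]. apply dot_le_Cmod.
    - unfold dB. pose proof (bloch_deriv_bound alpha M f _ Ha D1 (HM _ D1)) as X. rewrite D2 in X.
      set (p := Rpower (1 - t * r) (- alpha)) in *. assert (0 < p) by apply exp_pos.
      rewrite Rmult_assoc. apply Rmult_le_compat_l; [exact Pm|].
      apply Rle_trans with (M * p * r); [apply Rmult_le_compat_r; assumption|].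
      assert (X0 : 0 <= t * r) by nra.
      (* The right side is a convex combination of [1] and [alpha - 1], both at least [c]. *)
      assert (L : c <= 1 - t * r + (alpha - 1) * (t * r)).
      { pose proof (Rmult_le_compat_r (t * r) _ _ X0 Hca).
        pose proof (Rmult_le_compat_r (1 - t * r) _ _ (Rlt_le _ _ P) Hc1). lra. }
      replace (M * p * r) with (M / c * (r * (p * c))) by (field; lra).
      apply Rmult_le_compat_l; [apply Rdiv_le_0_compat; lra|].
      apply Rmult_le_compat_l; [exact Pr|]. apply Rmult_le_compat_l; lra. }
  assert (h1 : h 1 = m * m).
  { unfold h. rewrite Cmult_1_l. apply dot_self. }
  assert (h0 : h 0 = 0).
  { unfold h. rewrite Cmult_0_l, Hf0. unfold dot; simpl; ring. }
  assert (B0 : B 0 = 0) by (unfold B; ring).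
  assert (B1 : B 1 = m * (M / c * (r * Rpower (1 - r) (1 - alpha)))) by (unfold B; rewrite Rmult_1_l; ring).
  rewrite h0, h1, B0, B1 in Et.
  destruct Pm as [Pm | Pm].
  - apply Rmult_le_reg_l with m; [exact Pm|]. lra.
  - fold m. rewrite <- Pm. apply Rmult_le_pos; [apply Rdiv_le_0_compat; lra|].
    apply Rmult_le_pos; [exact Pr | left; apply exp_pos].
Qed.

(** * The integrand and the derivative of the Cesaro transform *)

Lemma continuous_C_mult (f g : C -> C) (z : C) :
  @continuous C_UniformSpace C_UniformSpace f z ->
  @continuous C_UniformSpace C_UniformSpace g z ->
  @continuous C_UniformSpace C_UniformSpace (fun w => f w * g w)%C z.
Proof.
  rewrite !continuous_C_eps. intros Hf Hg eps He.
  pose proof (Cmod_ge_0 (f z)) as Pf. pose proof (Cmod_ge_0 (g z)) as Pg.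
  set (S := Cmod (f z) + Cmod (g z) + 1).
  (* The [1] makes the product of the two increments at most one increment, so the total error is at
     most [e * S <= eps / 2]. *)
  assert (He' : 0 < Rmin 1 (eps / (2 * S))).
  { apply Rmin_glb_lt; [lra|]. apply Rdiv_lt_0_compat; unfold S; lra. }
  destruct (Hf _ He') as [d1 [Hd1 F]]. destruct (Hg _ He') as [d2 [Hd2 G]].
  exists (Rmin d1 d2). split; [apply Rmin_glb_lt; assumption|]. intros w Hw.
  specialize (F w (Rlt_le_trans _ _ _ Hw (Rmin_l _ _))).
  specialize (G w (Rlt_le_trans _ _ _ Hw (Rmin_r _ _))).
  pose proof (Rmin_l 1 (eps / (2 * S))). pose proof (Rmin_r 1 (eps / (2 * S))).
  set (e := Rmin 1 (eps / (2 * S))) in *.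
  replace (f w * g w - f z * g z)%C
    with ((f w - f z) * (g w - g z) + ((f w - f z) * g z + f z * (g w - g z)))%C by ring.
  pose proof (Cmod_triangle ((f w - f z) * (g w - g z)) ((f w - f z) * g z + f z * (g w - g z))) as T1.
  pose proof (Cmod_triangle ((f w - f z) * g z) (f z * (g w - g z))) as T2.
  rewrite !Cmod_mult in T2. rewrite Cmod_mult in T1.
  pose proof (Cmod_ge_0 (f w - f z)). pose proof (Cmod_ge_0 (g w - g z)).
  assert (e * S <= eps / 2).
  { apply Rle_trans with (eps / (2 * S) * S); [apply Rmult_le_compat_r; [unfold S; lra | assumption]|].
    right. field. unfold S; lra. }
  assert (Cmod (f w - f z) * Cmod (g w - g z) <= e * 1) by (apply Rmult_le_compat; lra).
  assert (Cmod (f w - f z) * Cmod (g z) <= e * Cmod (g z)) by (apply Rmult_le_compat_r; lra).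
  assert (Cmod (f z) * Cmod (g w - g z) <= Cmod (f z) * e) by (apply Rmult_le_compat_l; lra).
  unfold S in *. nra.
Qed.

(* The value at 0 replaces the junk value [f 0 / 0 = 0] of the integrand in [cesaro]; the two
   integrands differ at the endpoint [t = 0] only. *)
Definition difference_quotient (f : C -> C) (w : C) : C :=
  if Ceq_dec w 0 then C_derive f 0 else (f w / w)%C.

Definition cesaro_integrand (beta : R) (f : C -> C) (w : C) : C :=
  (difference_quotient f w * / cpow (1 - w) beta)%C.

Lemma cpow_neq_0 (z : C) (b : R) : cpow z b <> RtoC 0.
Proof. apply Cmod_gt_0. rewrite Cmod_cpow. apply exp_pos. Qed.

Lemma cpow_1_l (b : R) : cpow 1 b = RtoC 1.
Proof.
  unfold cpow, Clog, Arg. rewrite Cmod_1, ln_1. simpl.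
  destruct (Rlt_dec 0 1) as [_|N]; [|lra].
  replace (0 / 1) with 0 by field. rewrite atan_0.
  unfold cexp; simpl. replace (b * 0 - 0 * 0) with 0 by ring. replace (b * 0 + 0 * 0) with 0 by ring.
  rewrite exp_0, cos_0, sin_0. unfold RtoC. f_equal; ring.
Qed.

Lemma ex_derive_inv_cpow (b : R) (z : C) :
  in_disk z -> @ex_derive C_AbsRing C_NormedModule (fun w => / cpow (1 - w) b)%C z.
Proof.
  intros Hz.
  assert (Hp : 0 < fst (1 - z)%C).
  { pose proof (re_le_Cmod z) as R. unfold in_disk in Hz. apply Rabs_le_between in R.
    unfold Re in R. simpl. lra. }
  destruct (ex_derive_cpow b _ Hp) as [l Hl]. eexists.
  apply (is_derive_C_comp Cinv (fun w => cpow (1 - w) b)).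
  - apply is_derive_Cinv, cpow_neq_0.
  - apply (is_derive_C_comp (fun u => cpow u b) (fun w => 1 - w)%C); [exact Hl|].
    apply (@is_derive_minus C_AbsRing C_NormedModule (fun _ => RtoC 1) (fun w => w)).
    + apply (@is_derive_const C_AbsRing C_NormedModule).
    + apply is_derive_C_AbsRing, (@is_derive_id C_AbsRing).
Qed.

Lemma locally_C_AbsRing (z : C) (P : C -> Prop) (d : R) :
  0 < d -> (forall w, Cmod (w - z) < d -> P w) -> @locally (AbsRing_UniformSpace C_AbsRing) z P.
Proof. intros Hd H. exists (mkposreal d Hd). intros w Hw. apply H, Hw. Qed.

Lemma ex_derive_cesaro_integrand (beta : R) (f : C -> C) (z : C) :
  analytic_on_disk f -> in_disk z -> z <> RtoC 0 ->
  @ex_derive C_AbsRing C_NormedModule (cesaro_integrand beta f) z.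
Proof.
  intros Hf Hz Nz. destruct (Hf z Hz) as [l Hl].
  destruct (ex_derive_inv_cpow beta z Hz) as [p Hp].
  eexists. unfold cesaro_integrand.
  apply (is_derive_C_mult (difference_quotient f) (fun w => / cpow (1 - w) beta)%C); [|exact Hp].
  eapply (@is_derive_ext_loc C_AbsRing C_NormedModule (fun w => f w * / w)%C).
  (* The disk of radius [|z|] around [z] misses the origin, so the case distinction disappears on
     it. *)
  - apply locally_C_AbsRing with (Cmod z); [apply Cmod_gt_0, Nz|].
    intros w Hw. unfold difference_quotient. destruct (Ceq_dec w 0) as [-> | N]; [|reflexivity].
    exfalso. replace (0 - z)%C with (- z)%C in Hw by ring. rewrite Cmod_opp in Hw. lra.
  - apply is_derive_C_mult; [exact Hl | apply is_derive_Cinv, Nz].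
Qed.

(** At the origin, since [f 0 = 0], the convergence of [f w / w] is the definition of the derivative
    of [f]; elsewhere differentiability gives continuity. *)
Lemma continuous_cesaro_integrand (beta : R) (f : C -> C) (z : C) :
  analytic_on_disk f -> f 0 = RtoC 0 -> in_disk z ->
  @continuous C_UniformSpace C_UniformSpace (cesaro_integrand beta f) z.
Proof.
  intros Hf Hf0 Hz. destruct (Ceq_dec z 0) as [-> | Nz].
  - apply continuous_C_mult.
    + apply continuous_C_eps. intros e He.
      pose proof (C_derive_correct f 0 0 (Hf 0 in_disk_0)) as H.
      assert (He2 : 0 < e / 2) by lra.
      destruct (proj1 (is_derive_C_eps f 0 _) H _ He2) as [d [Hd Hfd]].
      exists d. split; [exact Hd|]. intros w Hw. specialize (Hfd w Hw).
      unfold difference_quotient. destruct (Ceq_dec 0 0) as [_ | N]; [|contradiction N; reflexivity].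
      destruct (Ceq_dec w 0) as [-> | N].
      * replace (_ - _)%C with (RtoC 0) by ring. rewrite Cmod_0. exact He.
      * replace (w - 0)%C with w in Hfd by ring. rewrite Hf0 in Hfd.
        replace (f w / w - C_derive f 0)%C with ((f w - 0 - C_derive f 0 * w) / w)%C by (field; exact N).
        pose proof (proj1 (Cmod_gt_0 w) N) as Pw.
        rewrite Cmod_div by exact N. apply Rle_lt_trans with (e / 2); [|lra].
        apply Rmult_le_reg_r with (Cmod w); [exact Pw|].
        unfold Rdiv at 1. rewrite Rmult_assoc, Rinv_l, Rmult_1_r by lra. exact Hfd.
    + destruct (ex_derive_inv_cpow beta 0 Hz) as [p Hp]. exact (is_derive_C_continuous _ _ _ Hp).
  - destruct (ex_derive_cesaro_integrand beta f z Hf Hz Nz) as [l Hl].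
    exact (is_derive_C_continuous _ _ _ Hl).
Qed.

Lemma is_RInt_cesaro (beta : R) (f : C -> C) (z : C) :
  analytic_on_disk f -> f 0 = RtoC 0 -> in_disk z ->
  @is_RInt C_R_NormedModule (fun t : R => f (RtoC t * z) /
      (RtoC t * z * cpow (1 - RtoC t * z) beta) * z)%C 0 1 (seg_int (cesaro_integrand beta f) 0 z).
Proof.
  intros Hf Hf0 Hz.
  eapply (@is_RInt_ext C_R_NormedModule);
    [|apply is_RInt_seg_int, continuous_on_seg_disk; auto using in_disk_0].
  - intros t. rewrite Rmin_left, Rmax_right by lra. intros Ht. simpl.
    replace (seg 0 z t) with (RtoC t * z)%C by (unfold seg; ring).
    replace (z - 0)%C with z by ring.
    (* For [z = 0] the whole path sits at the origin, where the two quotients may differ, but the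
       factor [z] annihilates both integrands. *)
    destruct (Ceq_dec z 0) as [Ez | Nz].
    + rewrite Ez, !Cmult_0_r. reflexivity.
    + assert (Ntz : (RtoC t * z)%C <> RtoC 0).
      { apply Cmult_neq_0; [|exact Nz]. intros E. apply (f_equal fst) in E. simpl in E. lra. }
      unfold cesaro_integrand, difference_quotient.
      destruct (Ceq_dec (RtoC t * z) 0) as [E | _]; [contradiction|].
      match goal with |- ?x = ?y => change (@eq C x y) end.
      set (w := (RtoC t * z)%C) in *. field. split; [apply cpow_neq_0 | exact Ntz].
  - intros w Hw. apply continuous_cesaro_integrand; assumption.
Qed.

Lemma cesaro_seg_int (beta : R) (f : C -> C) (z : C) :
  analytic_on_disk f -> f 0 = RtoC 0 -> in_disk z ->
  cesaro beta f z = seg_int (cesaro_integrand beta f) 0 z.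
Proof.
  intros Hf Hf0 Hz. apply (@is_RInt_unique C_R_CompleteNormedModule).
  apply is_RInt_cesaro; assumption.
Qed.

Lemma is_derive_cesaro (beta : R) (f : C -> C) (z : C) :
  analytic_on_disk f -> f 0 = RtoC 0 -> in_disk z ->
  @is_derive C_AbsRing C_NormedModule (cesaro beta f) z (cesaro_integrand beta f z).
Proof.
  intros Hf Hf0 Hz.
  apply (@is_derive_ext_loc C_AbsRing C_NormedModule (seg_int (cesaro_integrand beta f) 0)).
  (* The identification with [seg_int] is known only inside the disk, hence the neighbourhood of
     radius [1 - |z|]. *)
  - apply locally_C_AbsRing with (1 - Cmod z); [unfold in_disk in Hz; lra|].
    intros w Hw. symmetry. apply cesaro_seg_int; auto. unfold in_disk.
    replace w with (w - z + z)%C by ring. eapply Rle_lt_trans; [apply Cmod_triangle|]. lra.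
  - apply is_derive_seg_int; [| |exact Hz].
    + intros w Hw. apply continuous_cesaro_integrand; assumption.
    + intros w Hw N. apply ex_derive_cesaro_integrand; assumption.
Qed.

(** * The norm estimate and linearity *)

(** [2^alpha] comes from [1 - |z|^2 <= 2 (1 - |z|)], [2^(1 - beta)] from [|1 - z| <= 2], and the
    denominator is the constant [c] of [bloch_growth]. *)
Definition cesaro_bound (alpha beta : R) : R :=
  Rpower 2 alpha * Rpower 2 (1 - beta) / Rmin 1 (alpha - 1).

(* Since beta <= 1, |1 - z|^(- beta) = |1 - z|^(1 - beta) / |1 - z| is at most
   2^(1 - beta) / (1 - |z|), which absorbs the factor 1 - |z| left over from the growth bound. *)
Lemma bloch_weight_cesaro (alpha beta M : R) (f : C -> C) (z : C) :
  beta <= 1 -> 1 < alpha -> analytic_on_disk f -> f 0 = RtoC 0 ->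
  (forall w, in_disk w -> bloch_weight alpha f w <= M) -> in_disk z ->
  bloch_weight alpha (cesaro beta f) z <= cesaro_bound alpha beta * M.
Proof.
  intros Hb Ha Hf Hf0 HM Hz.
  assert (M0 : 0 <= M).
  { specialize (HM 0 in_disk_0). eapply Rle_trans; [|exact HM].
    apply Rmult_le_pos; [left; apply exp_pos | apply Cmod_ge_0]. }
  unfold bloch_weight, cderiv.
  rewrite (is_C_derive_unique _ _ _ (is_derive_cesaro beta f z Hf Hf0 Hz)).
  unfold cesaro_bound. set (c := Rmin 1 (alpha - 1)).
  assert (c1 : c <= 1) by apply Rmin_l. assert (ca : c <= alpha - 1) by apply Rmin_r.
  assert (c0 : 0 < c) by (apply Rmin_glb_lt; lra).
  assert (one_le : forall a, 0 <= a -> 1 <= Rpower 2 a).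
  { intros a H. rewrite <- (Rpower_O 2) by lra. apply Rle_Rpower; lra. }
  assert (A1 := one_le alpha ltac:(lra)). assert (A2 := one_le (1 - beta) ltac:(lra)).
  unfold cesaro_integrand, difference_quotient. destruct (Ceq_dec z 0) as [-> | Nz].
  (* At the origin the integrand is the derivative of [f], so the weight is that of [f] itself; it
     remains that the constant is at least [1]. *)
  - replace (1 - 0)%C with (RtoC 1) by ring. rewrite cpow_1_l.
    replace (C_derive f 0 * / 1)%C with (C_derive f 0) by field.
    eapply Rle_trans; [apply (HM 0 in_disk_0)|].
    rewrite <- (Rmult_1_l M) at 1. apply Rmult_le_compat_r; [exact M0|].
    apply Rmult_le_reg_r with c; [exact c0|]. unfold Rdiv.
    rewrite Rmult_assoc, Rinv_l, Rmult_1_r by lra. nra.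
  - pose proof (proj1 (Cmod_gt_0 z) Nz) as Pz.
    pose proof (bloch_growth alpha M c f z ltac:(lra) c0 c1 ca Hf Hf0 HM Hz) as Gr.
    unfold Cdiv. rewrite !Cmod_mult, !Cmod_inv by (exact Nz || apply cpow_neq_0).
    rewrite Cmod_cpow. unfold in_disk in Hz. set (r := Cmod z) in *. set (q := Cmod (1 - z)).
    assert (q1 : 1 - r <= q).
    { pose proof (Cmod_triangle (1 - z) z) as T. replace (1 - z + z)%C with (RtoC 1) in T by ring.
      rewrite Cmod_1 in T. fold q r in T. lra. }
    assert (q2 : q <= 2).
    { pose proof (Cmod_triangle 1 (- z)) as T. rewrite Cmod_1, Cmod_opp in T.
      fold (Cminus 1 z) in T. fold q r in T. lra. }
    rewrite <- Rpower_Ropp.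
    assert (S1 : Rpower (1 - r ^ 2) alpha <= Rpower (1 - r) alpha * Rpower 2 alpha).
    { rewrite Rpower_mult_distr by lra. apply Rpower_le_base; nra. }
    assert (S2 : (1 - r) * Rpower q (- beta) <= Rpower 2 (1 - beta)).
    { apply Rle_trans with (q * Rpower q (- beta)).
      - apply Rmult_le_compat_r; [left; apply exp_pos | exact q1].
      - rewrite <- Rpower_1_minus by lra. apply Rpower_le_base; lra. }
    assert (S3 : Rpower (1 - r) alpha * Rpower (1 - r) (1 - alpha) = 1 - r).
    { rewrite <- Rpower_plus. replace (alpha + (1 - alpha)) with 1 by ring. apply Rpower_1; lra. }
    assert (S4 : Cmod (f z) * / r <= M / c * Rpower (1 - r) (1 - alpha)).
    { apply Rmult_le_reg_r with r; [exact Pz|].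
      rewrite Rmult_assoc, Rinv_l, Rmult_1_r by lra. lra. }
    assert (P1 : 0 < Rpower q (- beta)) by apply exp_pos.
    assert (P2 : 0 < Rpower (1 - r ^ 2) alpha) by apply exp_pos.
    assert (P3 : 0 < Rpower (1 - r) (1 - alpha)) by apply exp_pos.
    assert (P4 : 0 <= M / c) by (apply Rdiv_le_0_compat; lra).
    (* The powers [alpha] and [1 - alpha] of [1 - r] then combine to the single factor [1 - r] that
       [S2] consumes. *)
    apply Rle_trans with ((Rpower (1 - r) alpha * Rpower 2 alpha)
        * (M / c * Rpower (1 - r) (1 - alpha) * Rpower q (- beta))).
    + apply Rmult_le_compat; [lra| |exact S1|].
      * repeat apply Rmult_le_pos; try lra. apply Cmod_ge_0. left; apply Rinv_0_lt_compat, Pz.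
      * apply Rmult_le_compat_r; lra.
    + replace (_ * _) with (Rpower 2 alpha * (M / c)
        * (Rpower (1 - r) alpha * Rpower (1 - r) (1 - alpha) * Rpower q (- beta))) by ring.
      rewrite S3.
      replace (Rpower 2 alpha * Rpower 2 (1 - beta) / c * M)
        with (Rpower 2 alpha * (M / c) * Rpower 2 (1 - beta)) by (field; lra).
      apply Rmult_le_compat_l; [apply Rmult_le_pos; lra | exact S2].
Qed.

(** The integral is taken in [C] as a real module, so a complex factor is moved through it by
    components. *)
Lemma is_RInt_Cmult_l (k : C) (f : R -> C) (a b : R) (l : C) :
  @is_RInt C_R_NormedModule f a b l ->
  @is_RInt C_R_NormedModule (fun t => k * f t)%C a b (k * l)%C.
Proof.
  intros H.
  pose proof (@is_RInt_fct_extend_fst R_NormedModule R_NormedModule f a b l H) as H1.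
  pose proof (@is_RInt_fct_extend_snd R_NormedModule R_NormedModule f a b l H) as H2.
  apply (@is_RInt_fct_extend_pair R_NormedModule R_NormedModule (fun t => k * f t)%C a b).
  - apply (is_RInt_minus (fun t => fst k * fst (f t)) (fun t => snd k * snd (f t)));
      apply (@is_RInt_scal R_NormedModule); assumption.
  - apply (is_RInt_plus (fun t => fst k * snd (f t)) (fun t => snd k * fst (f t)));
      apply (@is_RInt_scal R_NormedModule); assumption.
Qed.

Theorem theorem2p3 (alpha beta : R) (hb : beta <= 1) (ha : 1 < alpha) :
  (forall f, bloch0 alpha f -> bloch0 alpha (cesaro beta f))
  /\ (forall (a b : C) (f g : C -> C), bloch0 alpha f -> bloch0 alpha g ->
        forall z, in_disk z ->
          cesaro beta (fun w => Cplus (Cmult a (f w)) (Cmult b (g w))) z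
          = Cplus (Cmult a (cesaro beta f z)) (Cmult b (cesaro beta g z)))
  /\ (exists K : R, 0 <= K /\ forall f, bloch0 alpha f ->
        real (bloch_norm alpha (cesaro beta f)) <= K * real (bloch_norm alpha f)).
Proof.
  assert (Bound : forall f, bloch0 alpha f -> is_finite (bloch_norm alpha (cesaro beta f)) /\
    real (bloch_norm alpha (cesaro beta f)) <= cesaro_bound alpha beta * real (bloch_norm alpha f)).
  { intros f [Bf f0]. apply bloch_norm_bounded. intros z Hz.
    apply bloch_weight_cesaro; auto; [apply Bf|].
    intros w Hw. apply bloch_weight_le; assumption. }
  repeat split.
  - intros z Hz. eexists. apply is_derive_cesaro; [apply H | apply H | exact Hz].
  - apply (Bound f H).
  - rewrite cesaro_seg_int; [apply seg_int_refl | apply H | apply H | apply in_disk_0].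
  - intros a b f g [[Af _] f0] [[Ag _] g0] z Hz.
    rewrite (cesaro_seg_int beta f z), (cesaro_seg_int beta g z) by assumption.
    pose proof (@is_RInt_plus C_R_NormedModule _ _ _ _ _ _
      (is_RInt_Cmult_l a _ _ _ _ (is_RInt_cesaro beta f z Af f0 Hz))
      (is_RInt_Cmult_l b _ _ _ _ (is_RInt_cesaro beta g z Ag g0 Hz))) as S.
    apply (@is_RInt_unique C_R_CompleteNormedModule).
    eapply (@is_RInt_ext C_R_NormedModule); [|exact S].
    (* With division read as multiplication by an inverse the identity is linear in [f w] and [g w],
       and so holds even where [w * p] vanishes. *)
    intros t _. cbv zeta. set (w := (RtoC t * z)%C). set (p := cpow (1 - w) beta).
    change (a * (f w / (w * p) * z) + b * (g w / (w * p) * z)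
      = (a * f w + b * g w) / (w * p) * z)%C.
    unfold Cdiv. ring.
  - exists (cesaro_bound alpha beta). split.
    + apply Rdiv_le_0_compat; [|apply Rmin_glb_lt; lra].
      apply Rmult_le_pos; left; apply exp_pos.
    + intros f H. apply (Bound f H).
Qed.
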